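(* Let $M=\mathrm{Gr}(r;\mathbb{C}^n)=\mathrm{SU}(n)/\mathrm{S}(\mathrm{U}(r)\times\mathrm{U}(n-r))$ be the complex Grassmannian with its natural $\mathrm{SU}(n)$-action and the Kirillov-Kostant form $\omega_{\mathrm{KK}}$, and let $t$ be the r-matrix $$t=\frac{1}{4n}\sum_{1\le i<j\le n}X_{ij}\wedge Y_{ij}\in\Lambda^2\mathfrak{su}(n)$$ of $\mathfrak{su}(n)$. Then there exists a sufficiently small number $\lambda$ such that the Kirillov-Kostant form $\omega_{\mathrm{KK}}$ on $\mathrm{Gr}(r;\mathbb{C}^n)$ can be deformed by the twist $\lambda t$; that is, such that $\pi_{\mathrm{KK}}^{\lambda t}:=\pi_{\mathrm{KK}}-(\lambda t)_M$, where $\pi_{\mathrm{KK}}$ is the Poisson structure induced by $\omega_{\mathrm{KK}}$, is a nondegenerate Poisson structure on $M$ and hence induces a symplectic structure on $M$.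
   Context: $X_{ij}\in\mathfrak{su}(n)$ ($1\le i<j\le n$) is the matrix whose $(i,j)$-entry is $1$, whose $(j,i)$-entry is $-1$, and whose other entries are $0$. $Y_{ij}\in\mathfrak{su}(n)$ is the matrix whose $(i,j)$- and $(j,i)$-entries are $\sqrt{-1}$ and whose other entries are $0$. $\mathrm{S}(\mathrm{U}(r)\times\mathrm{U}(n-r))$ is the subgroup of block-diagonal matrices in $\mathrm{SU}(n)$ with blocks of sizes $r$ and $n-r$ (where $1\le r\le n-1$); $\mathrm{SU}(n)$ acts on $M$ by left multiplication on cosets. The Kirillov-Kostant form $\omega_{\mathrm{KK}}$ is the canonical symplectic form of a coadjoint orbit of $\mathrm{SU}(n)$ identified equivariantly with $M$: fix $\xi_0\in\mathfrak{su}(n)^*$ whose stabilizer under the coadjoint action is $\mathrm{S}(\mathrm{U}(r)\times\mathrm{U}(n-r))$, identify $M$ with the orbit of $\xi_0$, and at a point $\xi$ of the orbit put $\omega_{\mathrm{KK}}(\mathrm{ad}^*_X\xi,\mathrm{ad}^*_Y\xi)=\langle\xi,[X,Y]\rangle$ for $X,Y\in\mathfrak{su}(n)$ (up to the usual sign convention). For a manifold $M$ with an action $\sigma$ of a Lie group $G$ with Lie algebra $\mathfrak{g}$ and $X\in\mathfrak{g}$, $X_{M,p}=\frac{d}{ds}\big|_{s=0}\sigma_{\exp sX}(p)$. Elements $t\in\Lambda^2\mathfrak{g}$ are called twists; a twist $t$ is an r-matrix if $[t,t]:=[t^L,t^L]_e\in\Lambda^3\mathfrak{g}$ is $\mathrm{ad}$-invariant,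 where $t^L$ is the left-invariant $2$-vector field on $G$ with value $t$ at the identity $e$ and the bracket is the Schouten bracket. $t_M$ denotes the fundamental $2$-vector field on $M$, determined linearly by $(X\wedge Y)_M=X_M\wedge Y_M$. For a $2$-vector field $\pi$, $\pi^\sharp:T^*M\to TM$ is defined by $\langle\pi^\sharp(\alpha),\beta\rangle=\pi(\alpha,\beta)$; $\pi$ is nondegenerate if $\pi^\sharp_p$ is an isomorphism for every $p$, and Poisson if $[\pi,\pi]=0$ (Schouten bracket). A symplectic form $\omega$ and a nondegenerate Poisson structure $\pi$ induce each other via $\pi^\sharp(\iota_v\omega)=v$ for all tangent vectors $v$. A symplectic form $\omega$ is said to be deformed by a twist $t$ if $\pi-t_M$ is a nondegenerate Poisson structure, the deformed symplectic structure being the one it induces. *)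

(* Defs.v *)
From HB Require Import structures.
From mathcomp Require Import all_boot all_order all_algebra.
From mathcomp Require Import spectral.
From mathcomp Require Import complex.
From mathcomp Require Import all_classical all_reals all_analysis.

Set Implicit Arguments.
Unset Strict Implicit.
Unset Printing Implicit Defensive.

Import Order.TTheory GRing.Theory Num.Theory.
Import numFieldNormedType.Exports.

Local Open Scope classical_set_scope.
Local Open Scope ring_scope.
Local Open Scope complex_scope.
Local Open Scope sesquilinear_scope.

(* -------------------------------------------------------------------------- *)
(* A closed submanifold of W^*, dim W < oo, is presented by a set M of points *)
(* in a type P together with the linear coordinates x p w = <x p, w>, w : W.  *)
(* A vector of W^* is written as a function W -> R.  A covector at p is       *)
(* represented by an element of W = W^**; two of them agree on T_p M when     *)
(* they differ by an element of the annihilator of T_p M, that is             *)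
(* T_p^* M = W / conormal p.  Bivectors on T_p M are functions W -> W -> R of *)
(* two covectors.                                                             *)
(* -------------------------------------------------------------------------- *)

Fixpoint Ck (R : realType) (N k : nat) (F : 'rV[R]_N -> R) : Prop :=
  if k is k'.+1 then
    (forall y, differentiable F y) /\
    (forall v, Ck k' (fun y => 'D_v F y))
  else continuous F.

Section Submanifold.
Variables (R : realType) (P W : Type) (M : set P) (x : P -> W -> R).
Implicit Types (p : P) (w a b c : W) (v : W -> R) (f : P -> R).
Implicit Types pi rho : P -> W -> W -> R.

(* M is embedded, so that the velocities of the curves that are merely
   differentiable at 0 are those of the smooth curves. *)
Definition curve_at p v (g : R -> P) : Prop :=
  [/\ forall s, M (g s), g 0 = p &
      forall w, is_derive (0 : R) (1 : R) (fun s => x (g s) w) (v w)].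

Definition tangent p : set (W -> R) := [set v | exists g, curve_at p v g].

Definition conormal p : set W := [set w | forall v, tangent p v -> v w = 0].

(* M is closed, so that a function on M is smooth if and only if it is the
   restriction of a smooth function on W^*. *)
Definition smooth f : Prop :=
  exists (N : nat) (w : 'I_N -> W) (F : 'rV[R]_N -> R),
    (forall k, Ck k F) /\
    (forall p, M p -> f p = F (\row_i x p (w i))).

(* <df_p, v>, which for a smooth f does not depend on the curve *)
Definition differential f p v : R :=
  xget 0 [set c | exists2 g, curve_at p v g &
                  is_derive (0 : R) (1 : R) (f \o g) c].

(* <pi^sharp(a), b> = pi(a, b) *)
Definition sharp pi p a : W -> R := fun b => pi p a b.

(* Bilinearity and independence of the representatives of the covectors
   follow from the last two conditions. *)
Definition bivector_field pi : Prop :=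
  [/\ forall a b, smooth (fun p => pi p a b),
      forall p, M p -> forall a b, pi p a b = - pi p b a &
      forall p, M p -> forall a, tangent p (sharp pi p a)].

(* The Schouten bracket of two bivector fields, in linear coordinates:
   [pi, rho]^{abc} is the cyclic sum over (a, b, c) of
   pi^{cd} @_d rho^{ab} + rho^{cd} @_d pi^{ab}. *)
Definition schouten_term pi rho p a b c : R :=
  differential (fun q => rho q a b) p (sharp pi p c) +
  differential (fun q => pi q a b) p (sharp rho p c).

Definition schouten pi rho p a b c : R :=
  schouten_term pi rho p a b c + schouten_term pi rho p b c a
  + schouten_term pi rho p c a b.

Definition poisson pi : Prop :=
  bivector_field pi /\
  forall p, M p -> forall a b c, schouten pi pi p a b c = 0.

(* pi_p^sharp : W / conormal p -> T_p M is an isomorphism *)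
Definition nondegenerate pi : Prop :=
  forall p, M p ->
    (forall a, sharp pi p a = (fun=> 0) <-> conormal p a) /\
    (forall v, tangent p v -> exists a, sharp pi p a = v).

(* The bivector field pi induced by a nondegenerate 2-form omega:
   pi^sharp(iota_v omega) = v. *)
Definition bivector_of_form (omega : P -> (W -> R) -> (W -> R) -> R) :
    P -> W -> W -> R := fun p a =>
  xget (fun=> 0) [set v | tangent p v /\
                          forall u, tangent p u -> omega p v u = u a].

End Submanifold.

(* the complex matrices as a real vector space *)
Definition cmx (R : realType) (n : nat) : Type := 'M[R[i]]_n.

Section Cmx.
Variables (R : realType) (n : nat).

HB.instance Definition _ := GRing.Zmodule.copy (cmx R n) 'M[R[i]]_n.

Definition cmx_scale (a : R) (A : cmx R n) : cmx R n :=
  a%:C *: (A : 'M[R[i]]_n).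

Fact cmx_scaleA a b A : cmx_scale a (cmx_scale b A) = cmx_scale (a * b) A.
Proof. by rewrite /cmx_scale scalerA rmorphM. Qed.
Fact cmx_scale1 : left_id 1 cmx_scale.
Proof. by move=> A; rewrite /cmx_scale rmorph1 scale1r. Qed.
Fact cmx_scaleDr : right_distributive cmx_scale +%R.
Proof. by move=> a A B; rewrite /cmx_scale scalerDr. Qed.
Fact cmx_scaleDl A : {morph cmx_scale^~ A : a b / a + b}.
Proof. by move=> a b; rewrite /cmx_scale rmorphD scalerDl. Qed.

HB.instance Definition _ := GRing.Zmodule_isLmodule.Build R (cmx R n)
  cmx_scaleA cmx_scale1 cmx_scaleDr cmx_scaleDl.

Definition in_su : {pred cmx R n} :=
  fun A => ((A : 'M[R[i]]_n)^t* == - A) && (\tr A == 0).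

Fact in_su_closed : subsemimod_closed in_su.
Proof.
split; [split|].
- by rewrite unfold_in; apply/andP; split;
    [rewrite oppr0 trmx0 map_mx0 | rewrite mxtrace0].
- move=> A B; rewrite !unfold_in => /andP[/eqP hA /eqP tA] /andP[/eqP hB /eqP tB].
  by rewrite linearD map_mxD hA hB opprD eqxx mxtraceD tA tB addr0 /=.
- move=> a A; rewrite !unfold_in => /andP[/eqP hA /eqP tA].
  have -> : a *: A = a%:C *: (A : 'M[R[i]]_n) by [].
  rewrite linearZ map_mxZ hA mxtraceZ tA mulr0 eqxx andbT scalerN.
  apply/eqP; congr (- (_ *: _)).
  by apply/conj_Creal/complex_realP; exists a.
Qed.

HB.instance Definition _ := GRing.isSubmodClosed.Build R (cmx R n) in_su
  in_su_closed.

Record su := Su { su_val :> cmx R n; _ : su_val \in in_su }.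

HB.instance Definition _ := [isSub for su_val].
HB.instance Definition _ := [Choice of su by <:].
HB.instance Definition _ := [SubChoice_isSubLmodule of su by <:].

(* the element of su(n) with matrix A; a dummy value if A is not in su(n) *)
Definition su_of (A : cmx R n) : su := insubd 0 A.

Lemma su_ofK A : A \in in_su -> su_val (su_of A) = A.
Proof. exact: insubdK. Qed.

Definition lie_mx (A B : cmx R n) : cmx R n := A *m B - B *m A.

Fact lie_in_su (X Y : su) : lie_mx X Y \in in_su.
Proof.
case: X Y => [A /= sA] [B /= sB].
move: sA sB; rewrite !unfold_in => /andP[/eqP hA _] /andP[/eqP hB _].
have hC : ((A : 'M[R[i]]_n) *m B - (B : 'M[R[i]]_n) *m A)^t* =
    B^t* *m A^t* - A^t* *m B^t*.
  by rewrite [X in map_mx _ X]linearB /= map_mxB !trmx_mul !map_mxM.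
apply/andP; split.
  rewrite /lie_mx hC hA hB; apply/eqP.
  by rewrite !mulNmx !mulmxN !opprK opprB.
by rewrite /lie_mx [mxtrace _]linearB /= mxtrace_mulC subrr.
Qed.

Definition lie (X Y : su) : su := Su (lie_in_su X Y).

Definition SU : set 'M[R[i]]_n := [set g | g \is unitarymx /\ \det g = 1].

Definition mexp (A : 'M[R[i]]_n) : 'M[R[i]]_n :=
  let S N := \sum_(k < N) (k`!%:R)^-1 *: A ^+ k in
  \matrix_(i, j) (limn (fun N => complex.Re (S N i j) : R^o) +i*
                  limn (fun N => complex.Im (S N i j) : R^o)).

(* used for g in SU(n) only, where g X g^-1 is in su(n) by Ad_in_su *)
Definition Ad (g : 'M[R[i]]_n) (X : su) : su := su_of (g *m su_val X *m invmx g).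

Lemma Ad_in_su (g : 'M[R[i]]_n) (X : su) : SU g ->
  (g *m su_val X *m invmx g : cmx R n) \in in_su.
Proof.
case: X => [A sA] [gU _] /=; move: sA; rewrite !unfold_in => /andP[/eqP hA tA].
rewrite (invmx_unitary gU) !trmx_mul !map_mxM hA trmxCK.
by rewrite mulNmx mulmxN mulmxA eqxx mxtrace_mulC -(invmx_unitary gU) mulmxA
  mulVmx ?mul1mx // unitarymx_unit.
Qed.

(* Elements of su(n)^* are written as functions su(n) -> R. *)
Definition coAd (g : 'M[R[i]]_n) (xi : su -> R) : su -> R :=
  fun X => xi (Ad (invmx g) X).

(* the derivative at s = 0 of coAd (mexp (s X)) xi *)
Definition coad (X : su) (xi : su -> R) : su -> R := fun Y => xi (lie Y X).

Lemma SU_unit (g : 'M[R[i]]_n) : SU g -> g \in unitmx.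
Proof. by case=> /unitarymx_unit. Qed.

Lemma SUV (g : 'M[R[i]]_n) : SU g -> SU (invmx g).
Proof.
by case=> gU g1; split; [rewrite (invmx_unitary gU) trmxC_unitary
                        | rewrite det_inv g1 invr1].
Qed.

Lemma SUM (g h : 'M[R[i]]_n) : SU g -> SU h -> SU (g *m h).
Proof.
by case=> gU g1 [hU h1]; split; [exact: mul_unitarymx | rewrite det_mulmx g1 h1 mulr1].
Qed.

Lemma AdE (g : 'M[R[i]]_n) X : SU g -> su_val (Ad g X) = g *m su_val X *m invmx g.
Proof. by move=> gS; rewrite /Ad su_ofK //; exact: Ad_in_su. Qed.

Lemma SU_invM (g h : 'M[R[i]]_n) : SU g -> SU h ->
  invmx (g *m h) = invmx h *m invmx g.
Proof.
move=> gS hS; apply: (can_inj (mulKmx (SU_unit (SUM gS hS)))).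
rewrite mulmxV ?(SU_unit (SUM gS hS)) // -mulmxA (mulmxA h).
by rewrite mulmxV ?(SU_unit hS) // mul1mx mulmxV ?(SU_unit gS).
Qed.

Lemma coAdM (g h : 'M[R[i]]_n) (xi : su -> R) : SU g -> SU h ->
  coAd (g *m h) xi = coAd g (coAd h xi).
Proof.
move=> gS hS; apply/funext => X; rewrite /coAd; congr (xi _); apply: val_inj => /=.
have gV := SUV gS; have hV := SUV hS.
rewrite SU_invM // !AdE //; last exact: SUM.
by rewrite SU_invM // !mulmxA.
Qed.

(* S(U(r) x U(n-r)) *)
Definition SUU (r : nat) : set 'M[R[i]]_n :=
  [set k | SU k /\ forall i j : 'I_n, (i < r)%N != (j < r)%N -> k i j = 0].

Definition coset (r : nat) (g : 'M[R[i]]_n) : set 'M[R[i]]_n :=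
  [set g *m k | k in SUU r].

(* Gr(r; C^n) = SU(n) / S(U(r) x U(n-r)) as a set of cosets, with the action of
   SU(n) by left multiplication *)
Definition Gr (r : nat) : set (set 'M[R[i]]_n) := [set coset r g | g in SU].

Definition lact (g : 'M[R[i]]_n) (p : set 'M[R[i]]_n) : set 'M[R[i]]_n :=
  [set g *m h | h in p].

(* The equivariant identification g S(U(r) x U(n-r)) |-> Ad^*_g xi0 of Gr(r; C^n)
   with the orbit of xi0.  It also gives the coordinates in which Gr(r; C^n) is
   a submanifold of su(n)^*. *)
Definition to_orbit (xi0 : su -> R) (p : set 'M[R[i]]_n) : su -> R :=
  coAd (xget 1%:M p) xi0.

Definition stabilizer_is (r : nat) (xi0 : su -> R) : Prop :=
  forall g, SU g -> (coAd g xi0 = xi0 <-> SUU r g).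

Lemma coAd1 (xi : su -> R) : coAd 1%:M xi = xi.
Proof.
apply/funext => X; rewrite /coAd invmx1; congr (xi _); apply: val_inj => /=.
have S1 : SU 1%:M.
  by split; [apply/unitarymxP; rewrite trmx1 map_mx1 mulmx1 | rewrite det1].
by rewrite AdE // invmx1 mulmx1 mul1mx.
Qed.

Lemma to_orbitE r (xi0 : su -> R) g : stabilizer_is r xi0 -> SU g ->
  to_orbit xi0 (coset r g) = coAd g xi0.
Proof.
move=> st gS; rewrite /to_orbit; case: xgetP => [_ -> [k [kS kb] <-]|no].
  by rewrite coAdM // (iffRL (st k kS)).
have S1 : SU 1%:M by rewrite -(mulmxV (SU_unit gS)); apply: SUM (SUV gS).
have k1 : SUU r 1%:M by apply/(st _ S1); exact: coAd1.
by case: (no g); exists 1%:M; rewrite ?mulmx1.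
Qed.

Lemma to_orbit_inj r (xi0 : su -> R) : stabilizer_is r xi0 ->
  forall p q, Gr r p -> Gr r q -> to_orbit xi0 p = to_orbit xi0 q -> p = q.
Proof.
move=> st _ _ [g gS <-] [h hS <-]; rewrite !to_orbitE // => e.
have key g' h' : SU g' -> SU h' -> coAd g' xi0 = coAd h' xi0 ->
    coset r g' `<=` coset r h'.
  move=> gS' hS' e' _ [k [kS kb] <-].
  have ak : coAd k xi0 = xi0 by apply/(st k kS); split.
  exists (invmx h' *m (g' *m k)).
    apply/st; first by apply: SUM (SUV hS') (SUM gS' kS).
    rewrite coAdM; [|exact: SUV|exact: SUM].
    rewrite coAdM // ak e' -(coAdM xi0 (SUV hS') hS').
    by rewrite mulVmx ?coAd1 // SU_unit.
  by rewrite mulKVmx // SU_unit.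
by apply/seteqP; split; apply: key.
Qed.

Lemma to_orbit_lact r (xi0 : su -> R) g p : stabilizer_is r xi0 -> SU g ->
  Gr r p -> to_orbit xi0 (lact g p) = coAd g (to_orbit xi0 p).
Proof.
move=> st gS [h hS <-].
have -> : lact g (coset r h) = coset r (g *m h).
  apply/seteqP; split => k /=.
    by case=> _ [l lS <-] <-; exists l; rewrite // mulmxA.
  by case=> l lS <-; exists (h *m l); [exists l | rewrite mulmxA].
rewrite !(to_orbitE st) ?coAdM //; exact: SUM.
Qed.

(* X_{M,p}, where the action is read through the coordinates x *)
Definition fund (x : set 'M[R[i]]_n -> su -> R) (X : su) (p : set 'M[R[i]]_n) :
    su -> R := fun a =>
  derive1 (fun s : R => x (lact (mexp (su_val (s *: X))) p) a : R^o) 0.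

(* A twist t in Lambda^2 su(n) is written as the corresponding alternating
   bilinear form on su(n)^*. *)
Definition bivec := (su -> R) -> (su -> R) -> R.

Definition wedge (X Y : su) : bivec := fun al be => al X * be Y - al Y * be X.

Definition scale_twist (lam : R) (t : bivec) : bivec :=
  fun al be => lam * t al be.

(* t_M is the image of t under Lambda^2 of X |-> X_{M,p}: a covector of M is
   pulled back to su(n), on which t is evaluated. *)
Definition fund_twist (x : set 'M[R[i]]_n -> su -> R) (t : bivec) :
    set 'M[R[i]]_n -> su -> su -> R := fun p a b =>
  t (fun X => fund x X p a) (fun X => fund x X p b).

Lemma fund_wedge x (X Y : su) p a b :
  fund_twist x (wedge X Y) p a b =
  fund x X p a * fund x Y p b - fund x Y p a * fund x X p b.
Proof. by []. Qed.

(* The left-invariant 2-vector field t^L, with SU(n) seen as a submanifold of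
   the space of complex matrices in the coordinates given by all real-linear
   functionals *)
Definition linform := {linear cmx R n -> R^o}.

Definition left_inv (t : bivec) : 'M[R[i]]_n -> linform -> linform -> R :=
  fun g l m => t (fun X => l (g *m su_val X : cmx R n))
                 (fun X => m (g *m su_val X : cmx R n)).

(* [t^L, t^L]_e; su(n) = T_e SU(n), so that Lambda^3 su(n) is evaluated on
   real-linear functionals too, and ad_Z acts through l |-> l \o ad Z *)
Definition twist_bracket (t : bivec) : linform -> linform -> linform -> R :=
  schouten SU (fun g (l : linform) => l (g : cmx R n))
    (left_inv t) (left_inv t) 1%:M.

Definition ad (Z : su) (A : cmx R n) : cmx R n := lie_mx Z A.

Fact ad_is_linear Z : linear (ad Z).
Proof.
move=> a A B; have e (D : cmx R n) : a *: D = a%:C *: (D : 'M[R[i]]_n) by [].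
rewrite /ad /lie_mx !e mulmxDr mulmxDl -scalemxAr -scalemxAl.
by rewrite opprD addrACA -scalerBr.
Qed.

HB.instance Definition _ (Z : su) :=
  GRing.isLinear.Build R (cmx R n) (cmx R n) *:%R (ad Z) (ad_is_linear Z).

Definition rmatrix (t : bivec) : Prop :=
  forall (Z : su) (l m k : linform),
    twist_bracket t (l \o ad Z) m k + twist_bracket t l (m \o ad Z) k
    + twist_bracket t l m (k \o ad Z) = 0.

Definition Xmx (i j : 'I_n) : cmx R n := delta_mx i j - delta_mx j i.
Definition Ymx (i j : 'I_n) : cmx R n :=
  'i%C *: (delta_mx i j + delta_mx j i : 'M[R[i]]_n).

Definition Xsu (i j : 'I_n) : su := su_of (Xmx i j).
Definition Ysu (i j : 'I_n) : su := su_of (Ymx i j).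

Lemma XsuE i j : i != j -> su_val (Xsu i j) = Xmx i j.
Proof.
move=> neq; apply: su_ofK; rewrite unfold_in /Xmx; apply/andP; split.
  apply/eqP/matrixP => k l; rewrite !mxE rmorphB !rmorph_nat opprB.
  by rewrite andbC [in X in _ - X]andbC.
by rewrite [mxtrace _]linearB /= -(mxtrace_tr (delta_mx i j)) trmx_delta subrr.
Qed.

Lemma YsuE i j : i != j -> su_val (Ysu i j) = Ymx i j.
Proof.
move=> neq; apply: su_ofK; rewrite unfold_in /Ymx; apply/andP; split.
  apply/eqP/matrixP => k l; rewrite !mxE rmorphM rmorphD !rmorph_nat.
  have ci : Num.conj ('i%C : R[i]) = - 'i%C by rewrite complexiE conjCi.
  rewrite -mulNr; congr (_ * _); first exact: ci.
  by rewrite addrC andbC [in X in _ + X]andbC.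
rewrite mxtraceZ mxtraceD -(mxtrace_tr (delta_mx i j)) trmx_delta.
rewrite /mxtrace big1 ?addr0 ?mulr0 // => k _; rewrite mxE.
by case: eqP => // ->; rewrite eq_sym (negbTE neq).
Qed.

Definition std_twist : bivec := fun al be =>
  (4 * n%:R)^-1 *
  \sum_(i < n) \sum_(j < n | (i < j)%N) wedge (Xsu i j) (Ysu i j) al be.

(* omega_KK (ad^*_X xi, ad^*_Y xi) = <xi, [X, Y]> at xi = to_orbit xi0 p, the
   tangent vectors of Gr(r; C^n) being read in su(n)^* *)
Definition omega_KK (xi0 : su -> R) (p : set 'M[R[i]]_n) (v w : su -> R) : R :=
  let xi := to_orbit xi0 p in
  xget 0 [set c | exists X Y : su,
    [/\ v = coad X xi, w = coad Y xi & c = xi (lie X Y)]].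

Definition deformed_by (M : set (set 'M[R[i]]_n))
    (x : set 'M[R[i]]_n -> su -> R)
    (omega : set 'M[R[i]]_n -> (su -> R) -> (su -> R) -> R) (t : bivec) : Prop :=
  let pi := fun p a b => bivector_of_form M x omega p a b - fund_twist x t p a b in
  poisson M x pi /\ nondegenerate M x pi.

End Cmx.

(* Main.v *)
(* A functional on su(n) is X |-> Re tr (A X) with A antihermitian, and then the
   standard twist t sends it to the element -2i kappa (tri_sgn A) of su(n), where
   kappa = 1/(4n) and tri_sgn multiplies the (i, j)-entry by the sign of j - i.
   The modified classical Yang-Baxter equation for tri_sgn identifies [t, t] with
   a multiple of tr ([A, B] C), which is ad-invariant.

   The stabilizer condition forces xi0 = Re tr (eta P .) with P the projection
   of rank r and eta imaginary, so the orbit is the set of Q = g (eta P) g^-1,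
   and Q^2 = eta Q.  There pi_KK sends a to ad^*_a xi, and pi_KK - lam t_M sends
   a to ad^*_b xi with b = a - lam Z_a, where Z_a is t applied to [Q, a].  In the
   Schouten bracket the terms of order at most 1 in lam cancel by the Jacobi
   identity; the term of order 2 is a multiple of tr ([[Q, a], [Q, b]] [Q, c]),
   which vanishes because [Q, .] exchanges the two eigenspaces of Q.  Since a |-> Z_a
   is bounded uniformly on the orbit, a |-> a - lam Z_a is invertible for small lam,
   which gives nondegeneracy.  Tangent vectors are all of the form ad^*_X xi: they
   are the velocities of exp (s X), and conversely differentiating Q^2 = eta Q gives
   Q' = [X, Q] with X = eta^-2 [Q', Q]. *)
From HB Require Import structures.
Require Import Defs.
From mathcomp Require Import all_boot all_order all_algebra.
From mathcomp Require Import fingroup perm spectral complex ring lra zify.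
From mathcomp Require Import all_classical all_reals all_analysis.
Set Implicit Arguments.
Unset Strict Implicit.
Unset Printing Implicit Defensive.

Import Order.TTheory GRing.Theory Num.Theory.
Import numFieldNormedType.Exports.
Local Open Scope classical_set_scope.
Local Open Scope ring_scope.
Local Open Scope complex_scope.
Local Open Scope sesquilinear_scope.

(** * The Yang-Baxter equation for the triangular sign operator *)
Section Commutator.
Variables (F : comNzRingType) (n : nat).
Implicit Types A B C : 'M[F]_n.

Definition lbr A B : 'M[F]_n := A *m B - B *m A.

Lemma tr_lbr A B C : \tr (lbr A B *m C) = \tr (A *m lbr B C).
Proof.
rewrite /lbr mulmxBl mulmxBr !raddfB /= !mulmxA; congr (_ - _).
by rewrite mxtrace_mulC mulmxA mxtrace_mulC mulmxA mxtrace_mulC mulmxA.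
Qed.

Lemma tr_lbr_cycle A B C : \tr (A *m lbr B C) = \tr (lbr C A *m B).
Proof. by rewrite tr_lbr [RHS]mxtrace_mulC -tr_lbr mxtrace_mulC. Qed.

Lemma lbrC A B : lbr A B = - lbr B A.
Proof. by rewrite /lbr opprB. Qed.

Lemma lbrNl A B : lbr (- A) B = - lbr A B.
Proof. by rewrite /lbr mulNmx mulmxN opprK opprB addrC. Qed.

Lemma lbr_subZ A B C z : lbr A (B - z *: C) = lbr A B - z *: lbr A C.
Proof.
rewrite /lbr mulmxBr mulmxBl -scalemxAr -scalemxAl.
move: (A *m B) (A *m C) (B *m A) (C *m A) => p q s t.
by apply/matrixP => i j; rewrite !mxE; ring.
Qed.

Lemma mxtrace_lbr A B : \tr (lbr A B) = 0.
Proof. by rewrite /lbr raddfB /= mxtrace_mulC subrr. Qed.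

Lemma lbr_jacobi A B C :
  lbr (lbr A C) B + lbr A (lbr B C) = lbr (lbr A B) C.
Proof.
rewrite /lbr !mulmxBl !mulmxBr !mulmxA.
move: (A *m C *m B) (C *m A *m B) (B *m A *m C) (B *m C *m A) => p q r s.
move: (A *m B *m C) (C *m B *m A) => t u.
by apply/matrixP => i j; rewrite !mxE; ring.
Qed.

Lemma lbr_jacobi_cycle A B C :
  lbr (lbr A B) C + lbr (lbr B C) A + lbr (lbr C A) B = 0.
Proof.
rewrite /lbr !mulmxBl !mulmxBr !mulmxA.
move: (A *m B *m C) (B *m A *m C) (C *m A *m B) (C *m B *m A) => p q r s.
move: (B *m C *m A) (A *m C *m B) => t u.
by apply/matrixP => i j; rewrite !mxE; ring.
Qed.

Lemma tr_lbr_invariant A B C Z : \tr (C *m lbr (lbr A Z) B)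
  + \tr (C *m lbr A (lbr B Z)) + \tr (lbr C Z *m lbr A B) = 0.
Proof.
rewrite -raddfD -mulmxDr lbr_jacobi tr_lbr -raddfD -mulmxDr.
by rewrite [lbr Z _]lbrC subrr mulmx0 raddf0.
Qed.

Definition ord_sgn (i j : 'I_n) : F := (i < j)%:R - (j < i)%:R.

Definition tri_sgn A : 'M[F]_n := \matrix_(i, j) (ord_sgn i j * A i j).

Fact tri_sgn_is_linear : linear tri_sgn.
Proof. by move=> a A B; apply/matrixP => i j; rewrite !mxE; ring. Qed.

HB.instance Definition _ :=
  GRing.isLinear.Build F 'M[F]_n 'M[F]_n *:%R tri_sgn tri_sgn_is_linear.

Definition tri_lbr L A : 'M[F]_n := tri_sgn (lbr L A + lbr L A).

Definition tri_lbr_resolvent (z : F) L A : 'M[F]_n := A - z *: tri_lbr L A.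

Fact tri_lbr_resolvent_is_linear z L : linear (tri_lbr_resolvent z L).
Proof.
move=> c B C; rewrite /tri_lbr_resolvent /tri_lbr /lbr.
rewrite mulmxDr mulmxDl -scalemxAr -scalemxAl.
move: (L *m B) (B *m L) (L *m C) (C *m L) => p q s t.
by apply/matrixP => i j; rewrite !mxE; ring.
Qed.

HB.instance Definition _ z L := GRing.isLinear.Build F 'M[F]_n 'M[F]_n *:%R
  (tri_lbr_resolvent z L) (tri_lbr_resolvent_is_linear z L).

Lemma ord_sgnC i j : ord_sgn i j = - ord_sgn j i.
Proof. by rewrite /ord_sgn opprB. Qed.

Lemma tr_tri_sgn A B : \tr (tri_sgn A *m B) = - \tr (A *m tri_sgn B).
Proof.
rewrite /mxtrace -sumrN; apply: eq_bigr => i _.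
rewrite !mxE -sumrN; apply: eq_bigr => j _.
by rewrite !mxE (ord_sgnC j i); ring.
Qed.

Lemma mxtrace_tri_sgn A : \tr (tri_sgn A) = 0.
Proof. by rewrite /mxtrace big1 // => i _; rewrite mxE /ord_sgn ltnn subrr mul0r. Qed.

Lemma ord_sgn_assoc i j k :
  ord_sgn i k * ord_sgn k j - ord_sgn i j * (ord_sgn i k + ord_sgn k j) + 1
  = ((i == k) && (k == j))%:R.
Proof.
rewrite /ord_sgn -!val_eqE /=.
case: (ltngtP i k) => ik; case: (ltngtP k j) => kj; case: (ltngtP i j) => ij /=;
  try ring; exfalso.
all: lia.
Qed.

(* The modified classical Yang-Baxter equation. *)
Lemma tri_sgn_mCYBE A B :
  lbr (tri_sgn A) (tri_sgn B) - tri_sgn (lbr (tri_sgn A) B + lbr A (tri_sgn B))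
  = - lbr A B.
Proof.
have key (C D : 'M[F]_n) i j :
    (tri_sgn C *m tri_sgn D - tri_sgn (tri_sgn C *m D + C *m tri_sgn D)
      + C *m D) i j = (i == j)%:R * (C i i * D i i).
  rewrite !mxE -big_split /= mulr_sumr -sumrB -big_split /=.
  rewrite (bigD1 i) //= big1 ?addr0 => [|k ki]; last first.
    rewrite !mxE; have := ord_sgn_assoc i j k.
    rewrite eq_sym (negPf ki) /= => h.
    by transitivity ((ord_sgn i k * ord_sgn k j
       - ord_sgn i j * (ord_sgn i k + ord_sgn k j) + 1) * (C i k * D k j));
      [ring | rewrite h mul0r].
  rewrite !mxE; have := ord_sgn_assoc i j i; rewrite eqxx /= => h.
  case: eqP h => [<-|_] h; last first.
    rewrite mul0r; transitivity ((ord_sgn i i * ord_sgn i j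
       - ord_sgn i j * (ord_sgn i i + ord_sgn i j) + 1) * (C i i * D i j)).
      by ring.
    by rewrite h mul0r.
  transitivity ((ord_sgn i i * ord_sgn i i
       - ord_sgn i i * (ord_sgn i i + ord_sgn i i) + 1) * (C i i * D i i)).
    by ring.
  by rewrite h !mul1r.
pose Y C D := tri_sgn C *m D + C *m tri_sgn D.
have sym : tri_sgn A *m tri_sgn B - tri_sgn (Y A B) + A *m B
         = tri_sgn B *m tri_sgn A - tri_sgn (Y B A) + B *m A.
  by apply/matrixP => i j; rewrite !key [A i i * _]mulrC.
have -> : lbr (tri_sgn A) B + lbr A (tri_sgn B) = Y A B - Y B A.
  by rewrite /lbr /Y addrACA [_ *m A + _]addrC opprD.
rewrite [tri_sgn (_ - _)]raddfB /= /lbr; move: sym.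
move: (tri_sgn A *m tri_sgn B) (tri_sgn B *m tri_sgn A) => a b.
move: (tri_sgn (Y A B)) (tri_sgn (Y B A)) => y z.
move: (A *m B) (B *m A) => p q h; apply/matrixP => i j.
have : (a - y + p) i j = (b - z + q) i j by rewrite h.
by rewrite !mxE => /eqP; rewrite -subr_eq0 => /eqP e; apply/eqP;
  rewrite -subr_eq0 -e; apply/eqP; ring.
Qed.

Lemma tr_tri_sgn_mCYBE A B C :
  \tr (A *m lbr (tri_sgn B) (tri_sgn C)) + \tr (B *m lbr (tri_sgn C) (tri_sgn A))
    + \tr (C *m lbr (tri_sgn A) (tri_sgn B)) = - \tr (C *m lbr A B).
Proof.
transitivity (\tr (C *m - lbr A B)); last by rewrite mulmxN raddfN.
rewrite -tri_sgn_mCYBE [in RHS]mulmxBr [RHS]raddfB /= -tr_tri_sgn.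
rewrite (mulmxDr (tri_sgn C)) [\tr (_ + _)]raddfD /= addrC.
rewrite [X in _ + X]addrC; congr (_ + (_ + _)).
  by rewrite -[RHS]tr_lbr mxtrace_mulC.
by rewrite [RHS]mxtrace_mulC tr_lbr.
Qed.

(* [Q, .] is off-diagonal with respect to the two eigenspaces of Q. *)
Lemma tr_comm_idem_triple (Q a b c : 'M[F]_n) (eta : F) : GRing.lreg eta ->
  Q *m Q = eta *: Q -> \tr (lbr Q a *m lbr Q b *m lbr Q c) = 0.
Proof.
move=> eta0 QQ; set A := lbr Q a; set B := lbr Q b; set C := lbr Q c.
have key D : Q *m lbr Q D = lbr Q D *m (eta%:M - Q).
  rewrite /lbr mulmxBr mulmxBl !mulmxBr !mul_mx_scalar mulmxA QQ.
  by rewrite -(mulmxA D Q Q) QQ -scalemxAr -scalemxAl subrr subr0 mulmxA.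
have key' D : (eta%:M - Q) *m lbr Q D = lbr Q D *m Q.
  move: (lbr Q D) (key D) => X keyX.
  by rewrite mulmxBl keyX mulmxBr mul_scalar_mx mul_mx_scalar opprB addrC subrK.
have kA : Q *m A = A *m (eta%:M - Q) := key a.
have kB : (eta%:M - Q) *m B = B *m Q := key' b.
have kC : Q *m C = C *m (eta%:M - Q) := key c.
have QABC : Q *m (A *m B *m C) = A *m B *m C *m (eta%:M - Q).
  by rewrite !mulmxA kA -(mulmxA A (_ - _)) kB !mulmxA -(mulmxA _ Q) kC mulmxA.
set T := A *m B *m C in QABC *.
have trQT : \tr (Q *m T) = 0.
  apply: eta0; rewrite mulr0 -mxtraceZ scalemxAl -QQ -mulmxA QABC.
  rewrite mulmxBr mul_mx_scalar mulmxBr raddfB /= -scalemxAr (mulmxA Q T).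
  by rewrite [\tr (Q *m T *m Q)]mxtrace_mulC (mulmxA Q Q) QQ -scalemxAl subrr.
apply: eta0; rewrite mulr0 -mxtraceZ -mul_mx_scalar.
rewrite -[eta%:M](subrK Q) mulmxDr raddfD /= -QABC trQT.
by rewrite mxtrace_mulC trQT addr0.
Qed.

End Commutator.

Lemma tr_double_lbr (F : comNzRingType) n (A B D : 'M[F]_n) :
  \tr (D *m A *m B) = 0 -> \tr (D *m B *m A) = 0 ->
  \tr ((D + D) *m lbr (A + A) (B + B)) = 0.
Proof.
move=> hAB hBA; rewrite /lbr mulmxBr raddfB /= !mulmxA.
by rewrite !mulmxDl !mulmxDr !mulmxDl !mxtraceD hAB hBA !addr0 subr0.
Qed.

Lemma lbr_lbr_idem (F : fieldType) n (Q D : 'M[F]_n) (eta : F) : eta != 0 ->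
  Q *m Q = eta *: Q -> D *m Q + Q *m D = eta *: D ->
  lbr (lbr D Q) Q = eta ^+ 2 *: D.
Proof.
move=> eta0 QQ DQ.
have QDQ : Q *m D *m Q = 0.
  have e1 : Q *m (D *m Q) *m Q = eta *: (Q *m D *m Q).
    by rewrite -!mulmxA QQ -!scalemxAr.
  have e2 : Q *m (Q *m D) *m Q = eta *: (Q *m D *m Q).
    by rewrite !mulmxA QQ -!scalemxAl.
  have e3 : Q *m (eta *: D) *m Q = eta *: (Q *m D *m Q).
    by rewrite -scalemxAr -scalemxAl.
  have := congr1 (fun B => Q *m B *m Q) DQ.
  rewrite mulmxDr mulmxDl e1 e2 e3 => /eqP.
  by rewrite -subr_eq0 addrK scaler_eq0 (negPf eta0) => /eqP.
have e1 : D *m Q *m Q = eta *: (D *m Q) by rewrite -mulmxA QQ -scalemxAr.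
have e2 : Q *m (Q *m D) = eta *: (Q *m D) by rewrite mulmxA QQ -scalemxAl.
rewrite /lbr mulmxBl mulmxBr e1 e2 mulmxA QDQ subr0 sub0r opprK.
by rewrite -scalerDr DQ scalerA.
Qed.

(** * Derivatives of curves of complex matrices *)
Section CplxDerivative.
Variable R : realType.
Local Notation C := R[i].
Local Notation Re := complex.Re.
Local Notation Im := complex.Im.

Definition cderive (f : R -> C) (d : C) : Prop :=
  is_derive (0 : R) (1 : R) (fun s => Re (f s)) (Re d) /\
  is_derive (0 : R) (1 : R) (fun s => Im (f s)) (Im d).

Lemma is_derive_eqfun (f g : R -> R) d : (forall s, f s = g s) ->
  is_derive (0 : R) (1 : R) f d -> is_derive (0 : R) (1 : R) g d.
Proof. by move=> fg; rewrite (_ : f = g) //; apply/funext. Qed.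

Lemma is_derive_uniq (f : R -> R) d e :
  is_derive (0 : R) (1 : R) f d -> is_derive (0 : R) (1 : R) f e -> d = e.
Proof. by move=> [_ <-] [_ <-]. Qed.

Lemma is_derive_mul (f g : R -> R) d e :
  is_derive (0 : R) (1 : R) f d -> is_derive (0 : R) (1 : R) g e ->
  is_derive (0 : R) (1 : R) (fun s => f s * g s) (d * g 0 + f 0 * e).
Proof.
move=> hf hg; have h := is_deriveM hf hg.
by apply: (is_derive_eq h); rewrite /GRing.scale /=; ring.
Qed.

Lemma cplx_ext (a b : C) : Re a = Re b -> Im a = Im b -> a = b.
Proof. by case: a b => [? ?] [? ?] /= -> ->. Qed.

Lemma cderive_cst c : cderive (fun=> c) 0.
Proof. by split; apply: is_derive_cst. Qed.

Lemma ReD (a b : C) : Re (a + b) = Re a + Re b. Proof. by case: a b => [? ?] []. Qed.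
Lemma ImD (a b : C) : Im (a + b) = Im a + Im b. Proof. by case: a b => [? ?] []. Qed.
Lemma ReN (a : C) : Re (- a) = - Re a. Proof. by case: a. Qed.
Lemma ImN (a : C) : Im (- a) = - Im a. Proof. by case: a. Qed.
Lemma ReM (a b : C) : Re (a * b) = Re a * Re b - Im a * Im b.
Proof. by case: a b => [? ?] []. Qed.
Lemma ImM (a b : C) : Im (a * b) = Re a * Im b + Im a * Re b.
Proof. by case: a b => [? ?] []. Qed.

Lemma ReC (a : C) : Re (Num.conj a) = Re a. Proof. by case: a. Qed.
Lemma ImC (a : C) : Im (Num.conj a) = - Im a. Proof. by case: a. Qed.

Lemma cderiveD f g d e : cderive f d -> cderive g e ->
  cderive (fun s => f s + g s) (d + e).
Proof.
move=> [f1 f2] [g1 g2]; split; rewrite ?ReD ?ImD.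
  by apply: (is_derive_eqfun _ (is_deriveD f1 g1)) => s; rewrite ReD.
by apply: (is_derive_eqfun _ (is_deriveD f2 g2)) => s; rewrite ImD.
Qed.

Lemma cderiveM f g d e : cderive f d -> cderive g e ->
  cderive (fun s => f s * g s) (d * g 0 + f 0 * e).
Proof.
move=> [f1 f2] [g1 g2]; split; rewrite ?ReD ?ImD.
  apply: (is_derive_eqfun (fun s => esym (ReM _ _))).
  have h := is_deriveB (is_derive_mul f1 g1) (is_derive_mul f2 g2).
  apply: (is_derive_eq h).
  by rewrite !ReM; ring.
apply: (is_derive_eqfun (fun s => esym (ImM _ _))).
have h := is_deriveD (is_derive_mul f1 g2) (is_derive_mul f2 g1).
apply: (is_derive_eq h).
by rewrite !ImM; ring.
Qed.

Lemma cderive_conj f d : cderive f d -> cderive (fun s => Num.conj (f s)) (Num.conj d).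
Proof.
move=> [f1 f2]; split.
  by rewrite ReC; apply: (is_derive_eqfun _ f1) => s; rewrite ReC.
by rewrite ImC; apply: (is_derive_eqfun _ (is_deriveN f2)) => s; rewrite ImC.
Qed.

Lemma cderive_sum (I : Type) (s : seq I) (f : I -> R -> C) (d : I -> C) :
  (forall i, cderive (f i) (d i)) ->
  cderive (fun t => \sum_(i <- s) f i t) (\sum_(i <- s) d i).
Proof.
move=> h; elim: s => [|i s IH].
  rewrite big_nil (_ : (fun _ => _) = fun=> 0); first exact: cderive_cst.
  by apply/funext => t; rewrite big_nil.
rewrite big_cons (_ : (fun _ => _) = fun t => f i t + \sum_(j <- s) f j t).
  exact: cderiveD.
by apply/funext => t; rewrite big_cons.
Qed.

Definition mderive (m n : nat) (A : R -> 'M[C]_(m, n)) (D : 'M[C]_(m, n)) : Prop :=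
  forall i j, cderive (fun s => A s i j) (D i j).

Lemma mderive_ext m n (A B : R -> 'M[C]_(m, n)) D :
  A =1 B -> mderive A D -> mderive B D.
Proof. by move=> /funext ->. Qed.

Lemma mderive_cst m n (A : 'M[C]_(m, n)) : mderive (fun=> A) 0.
Proof. by move=> i j; rewrite mxE; apply: cderive_cst. Qed.

Lemma mderiveM m n p (A : R -> 'M[C]_(m, n)) (B : R -> 'M[C]_(n, p)) D E :
  mderive A D -> mderive B E ->
  mderive (fun s => A s *m B s) (D *m B 0 + A 0 *m E).
Proof.
move=> hA hB i j; rewrite !mxE -big_split /=.
rewrite (_ : (fun _ => _) = fun s => \sum_k A s i k * B s k j).
  by apply: cderive_sum => k; apply: cderiveM.
by apply/funext => s; rewrite mxE.
Qed.

Lemma mderive_trmxC m n (A : R -> 'M[C]_(m, n)) D :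
  mderive A D -> mderive (fun s => (A s)^t*) (D^t*).
Proof.
move=> hA i j; rewrite !mxE (_ : (fun _ => _) = fun s => Num.conj (A s j i)).
  exact: cderive_conj.
by apply/funext => s; rewrite !mxE.
Qed.

Lemma mderiveZ m n (a : C) (A : R -> 'M[C]_(m, n)) D :
  mderive A D -> mderive (fun s => a *: A s) (a *: D).
Proof.
move=> hA i j; rewrite !mxE (_ : (fun _ => _) = fun s => a * (A s i j)).
  have := cderiveM (cderive_cst a) (hA i j); by rewrite mul0r add0r.
by apply/funext => s; rewrite !mxE.
Qed.

Lemma mderive_uniq m n (A : R -> 'M[C]_(m, n)) D E :
  mderive A D -> mderive A E -> D = E.
Proof.
move=> hD hE; apply/matrixP => i j.
have [d1 d2] := hD i j; have [e1 e2] := hE i j.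
have := is_derive_uniq d1 e1; have := is_derive_uniq d2 e2.
by case: (D i j) (E i j) => [? ?] [? ?] /= -> ->.
Qed.

Definition retr n (A : 'M[C]_n) : R := Re (\tr A).

Lemma mderive_retr n (A : R -> 'M[C]_n) D : mderive A D ->
  is_derive (0 : R) (1 : R) (fun s => retr (A s)) (retr D).
Proof.
move=> hA; have [h _] : cderive (fun s => \tr (A s)) (\tr D).
  by apply: cderive_sum => i; apply: hA.
exact: h.
Qed.

End CplxDerivative.

(** * Matrix exponential on su(n) *)
Section Exponential.
Variable R : realType.
Local Notation C := R[i].
Local Notation Re := complex.Re.
Local Notation Im := complex.Im.

Definition ccvg (f : nat -> C) (l : C) : Prop :=
  ((fun N => Re (f N)) @ \oo --> Re l) /\ ((fun N => Im (f N)) @ \oo --> Im l).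

Lemma ccvgMl c f l : ccvg f l -> ccvg (fun N => c * f N) (c * l).
Proof.
move=> [h1 h2]; split.
  rewrite ReM (_ : (fun _ => _) = fun N => Re c * Re (f N) - Im c * Im (f N)).
    by apply: cvgB; apply: cvgMr.
  by apply/funext => N; rewrite ReM.
rewrite ImM (_ : (fun _ => _) = fun N => Re c * Im (f N) + Im c * Re (f N)).
  by apply: cvgD; apply: cvgMr.
by apply/funext => N; rewrite ImM.
Qed.

Lemma ccvg_sum (I : Type) (s : seq I) (f : I -> nat -> C) (l : I -> C) :
  (forall i, ccvg (f i) (l i)) ->
  ccvg (fun N => \sum_(i <- s) f i N) (\sum_(i <- s) l i).
Proof.
move=> h; elim: s => [|i s [IH1 IH2]].
  by rewrite big_nil (_ : (fun _ => _) = fun=> 0);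
    [split; apply: cvg_cst | apply/funext => N; rewrite big_nil].
rewrite big_cons (_ : (fun _ => _) = fun N => f i N + \sum_(j <- s) f j N);
  last by apply/funext => N; rewrite big_cons.
have [h1 h2] := h i; split; rewrite ?ReD ?ImD.
  by under eq_fun do rewrite ReD; apply: cvgD.
by under eq_fun do rewrite ImD; apply: cvgD.
Qed.

Definition expi (x : R) : C := cos x +i* sin x.

Lemma expiD x y : expi (x + y) = expi x * expi y.
Proof. by rewrite /expi cosD sinD; congr (_ +i* _); ring. Qed.

Lemma expi0 : expi 0 = 1.
Proof. by rewrite /expi cos0 sin0. Qed.

Lemma expi_conj x : Num.conj (expi x) = expi (- x).
Proof. by rewrite /expi cosN sinN. Qed.

Lemma expi_normK x : expi x * Num.conj (expi x) = 1.
Proof. by rewrite expi_conj -expiD subrr expi0. Qed.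

Lemma expi_sum (I : Type) (s : seq I) (x : I -> R) :
  expi (\sum_(i <- s) x i) = \prod_(i <- s) expi (x i).
Proof. by apply: (big_morph expi); [exact: expiD | exact: expi0]. Qed.

Lemma cderive_expi (x : R) : cderive (fun s => expi (s * x)) (0 +i* x).
Proof.
have hx : is_derive (0 : R) (1 : R) (fun s : R => s * x) x.
  have h := is_derive_mul (is_derive_id (0 : R) (1 : R)) (is_derive_cst x (0 : R) (1 : R)).
  by apply: (is_derive_eq h); rewrite mulr0 addr0 mul1r.
split; rewrite /expi /=.
  have h : is_derive (0 * x) 1 (cos : R -> R) (- sin (0 * x)) by apply: is_derive_cos.
  by apply: (is_derive_eq (@is_derive1_comp R cos ( *%R^~ x) 0 _ _ h hx));
    rewrite mul0r sin0 oppr0 mul0r.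
have h : is_derive (0 * x) 1 (sin : R -> R) (cos (0 * x)) by apply: is_derive_sin.
by apply: (is_derive_eq (@is_derive1_comp R sin ( *%R^~ x) 0 _ _ h hx));
  rewrite mul0r cos0 mul1r.
Qed.

Lemma exprI (x : R) k : (0 +i* x) ^+ k =
  ((~~ odd k)%:R * (-1) ^+ k./2 * x ^+ k) +i* ((odd k)%:R * (-1) ^+ k.-1./2 * x ^+ k).
Proof.
elim: k => [|k IH]; first by rewrite !expr0 /= !mul1r !mul0r.
rewrite exprS IH /=; case: k {IH} => [|k] /=.
  by apply: cplx_ext; rewrite ?ReM ?ImM /= !expr0 expr1 /=; ring.
by apply: cplx_ext; rewrite ?ReM ?ImM /= !exprS; case: (odd k) => /=; ring.
Qed.

Lemma ccvg_expi (x : R) :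
  ccvg (fun N => \sum_(k < N) (k`!%:R)^-1 * (0 +i* x) ^+ k) (expi x).
Proof.
have e N : \sum_(k < N) (k`!%:R)^-1 * (0 +i* x : C) ^+ k =
    series (cos_coeff x) N +i* series (sin_coeff x) N.
  rewrite /series /= !big_mkord; elim: N => [|N IH]; first by rewrite !big_ord0.
  rewrite !big_ord_recr /= IH exprI /cos_coeff /sin_coeff /=.
  rewrite -[(N`!%:R)^-1 : C](_ : (N`!%:R)^-1%:C = _); last first.
    by rewrite fmorphV rmorph_nat.
  by apply: cplx_ext; rewrite ?(ReD, ImD, ReM, ImM) /= -?exprnP; ring.
under eq_fun do rewrite e.
split=> /=; rewrite unlock.
  exact: is_cvg_series_cos_coeff.
exact: is_cvg_series_sin_coeff.
Qed.
End Exponential.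

Section ExpSU.
Variables (R : realType) (n : nat).
Local Notation C := R[i].
Local Notation Re := complex.Re.
Local Notation Im := complex.Im.

Lemma in_suP (A : cmx R n) :
  reflect ((A : 'M[C]_n)^t* = - (A : 'M[C]_n) /\ \tr A = 0) (A \in in_su (n := n)).
Proof. by rewrite unfold_in; apply: (iffP andP) => -[/eqP h /eqP t]. Qed.

Lemma su_trmxC (X : su R n) : (su_val X : 'M[C]_n)^t* = - (su_val X : 'M[C]_n).
Proof. by have /in_suP[] := valP X. Qed.

Lemma su_tr (X : su R n) : \tr (su_val X : 'M[C]_n) = 0.
Proof. by have /in_suP[] := valP X. Qed.

Lemma su_valZ a (X : su R n) : su_val (a *: X) = a%:C *: (su_val X : 'M[C]_n).
Proof. by []. Qed.
Lemma su_valD (X Y : su R n) :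
  su_val (X + Y) = (su_val X : 'M[C]_n) + su_val Y.
Proof. by []. Qed.

Lemma su_valN (X : su R n) : su_val (- X) = - (su_val X : 'M[C]_n).
Proof. by []. Qed.
Lemma su_valBZ a (X Y : su R n) :
  su_val (X - a *: Y) = (su_val X : 'M[C]_n) - a%:C *: (su_val Y : 'M[C]_n).
Proof. by rewrite su_valD su_valN su_valZ. Qed.

Lemma su_diagonalize (X : su R n) : exists (U : 'M[C]_n) (t : 'I_n -> R),
  [/\ U \is unitarymx, \sum_i t i = 0 &
      (su_val X : 'M[C]_n) = U^t* *m diag_mx (\row_i (0 +i* t i)) *m U].
Proof.
set A : 'M[C]_n := su_val X.
have nA : A \is normalmx.
  by apply/normalmxP; rewrite su_trmxC mulmxN mulNmx.
have := orthomx_spectralP nA; set U := spectralmx A; set d := spectral_diag A => eA.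
have uU : U \is unitarymx := spectral_unitarymx A.
exists U, (fun i => Im (d 0 i)).
have UU : U *m U^t* = 1%:M by apply/unitarymxP.
have eA' : A = U^t* *m diag_mx d *m U by rewrite -(invmx_unitary uU).
have eD : diag_mx d = U *m A *m U^t*.
  by rewrite eA' !mulmxA UU mul1mx -mulmxA UU mulmx1.
have eDN : (diag_mx d)^t* = - diag_mx d.
  by rewrite eD !trmx_mul !map_mxM su_trmxC trmxCK mulNmx mulmxN mulmxA.
have dI i : d 0 i = 0 +i* Im (d 0 i).
  have := congr1 (fun M : 'M[C]_n => M i i) eDN; rewrite !mxE eqxx !mulr1n => e.
  apply: cplx_ext => //=; have := congr1 (@complex.Re R) e; rewrite ReC ReN; lra.
have dE : \row_i (0 +i* Im (d 0 i)) = d.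
  by apply/rowP => i; rewrite mxE -dI.
split; [exact: uU | | by rewrite dE].
have := su_tr X; rewrite -/A eA' mxtrace_mulC mulmxA UU mul1mx mxtrace_diag.
move=> /(congr1 (@complex.Im R)); rewrite (big_morph (@complex.Im R) (@ImD R) (erefl _)).
by move=> ->.
Qed.

Lemma trmxC_mul m p q (A : 'M[C]_(m, p)) (B : 'M[C]_(p, q)) :
  (A *m B)^t* = B^t* *m A^t*.
Proof. by rewrite trmx_mul map_mxM. Qed.

Lemma mulmx_similar (U V D E : 'M[C]_n) : U *m V = 1%:M ->
  V *m D *m U *m (V *m E *m U) = V *m (D *m E) *m U.
Proof. by move=> UV; rewrite !mulmxA -(mulmxA (V *m D)) UV mulmx1. Qed.

Lemma similar_diagX (U V : 'M[C]_n) (d : 'rV_n) k : U *m V = 1%:M ->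
  (V *m diag_mx d *m U) ^+ k = V *m diag_mx (\row_i d 0 i ^+ k) *m U.
Proof.
move=> UV; elim: k => [|k IH].
  have -> : \row_i d 0 i ^+ 0 = const_mx 1.
    by apply/rowP => i; rewrite !mxE expr0.
  by rewrite expr0 diag_const_mx mulmx1; apply/esym/mulmx1C.
rewrite exprSr IH; apply: etrans (mulmx_similar _ _ UV) _.
rewrite mulmx_diag; congr (_ *m diag_mx _ *m _).
by apply/rowP => i; rewrite !mxE exprSr.
Qed.

Lemma mexp_diag (U : 'M[C]_n) (t : 'I_n -> R) : U \is unitarymx ->
  mexp (U^t* *m diag_mx (\row_i (0 +i* t i)) *m U) =
  U^t* *m diag_mx (\row_i expi (t i)) *m U.
Proof.
move=> uU; have UU : U *m U^t* = 1%:M by apply/unitarymxP.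
set d := \row_i _; set A := _ *m U.
have AX k : A ^+ k = U^t* *m diag_mx (\row_i (0 +i* t i) ^+ k) *m U.
  have -> : \row_i (0 +i* t i) ^+ k = \row_i d 0 i ^+ k.
    by apply/rowP => i; rewrite !mxE.
  exact: similar_diagX UU.
rewrite /mexp; apply/matrixP => i j; rewrite mxE.
pose S N : 'M[C]_n := \sum_(k < N) (k`!%:R)^-1 *: A ^+ k.
have cv : ccvg (fun N => S N i j) ((U^t* *m diag_mx (\row_i expi (t i)) *m U) i j).
  have -> : (U^t* *m diag_mx (\row_i expi (t i)) *m U) i j =
      \sum_k (Num.conj (U k i) * U k j) * expi (t k).
    rewrite mul_mx_diag !mxE; apply: eq_bigr => k _; rewrite !mxE; ring.
  have -> : (fun N => S N i j) = fun N => \sum_k (Num.conj (U k i) * U k j) *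
      (\sum_(m < N) (m`!%:R)^-1 * (0 +i* t k) ^+ m).
    apply/funext => N; rewrite /S summxE.
    under [RHS]eq_bigr do rewrite mulr_sumr.
    rewrite exchange_big /=; apply: eq_bigr => m _.
    rewrite AX mul_mx_diag !mxE mulr_sumr; apply: eq_bigr => k _.
    rewrite !mxE; ring.
  by apply: ccvg_sum => k; apply: ccvgMl; apply: ccvg_expi.
have [c1 c2] := cv.
by apply: cplx_ext; apply: cvg_lim.
Qed.

Lemma mexp_su (X : su R n) : [/\ forall s : R, SU (mexp (su_val (s *: X))),
  mexp (su_val ((0 : R) *: X)) = 1%:M &
  mderive (fun s : R => mexp (su_val (s *: X))) (su_val X)].
Proof.
have [U [t [uU st eX]]] := su_diagonalize X.
have UU : U *m U^t* = 1%:M by apply/unitarymxP.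
have UU' : U^t* *m U = 1%:M by apply: mulmx1C.
have E s : mexp (su_val (s *: X)) = U^t* *m diag_mx (\row_i expi (s * t i)) *m U.
  rewrite su_valZ eX scalemxAl scalemxAr.
  have -> : s%:C *: diag_mx (\row_i (0 +i* t i)) = diag_mx (\row_i (0 +i* (s * t i))).
    apply/matrixP => i j; rewrite !mxE mulrnAr; congr (_ *+ _).
    by apply: cplx_ext; rewrite ?(ReM, ImM) /=; ring.
  exact: mexp_diag.
have E0 : mexp (su_val ((0 : R) *: X)) = 1%:M.
  rewrite E (_ : \row_i expi (0 * t i) = const_mx 1) ?diag_const_mx ?mulmx1 //.
  by apply/rowP => i; rewrite !mxE mul0r expi0.
split; [move=> s | exact: E0 |].
  rewrite E; split.
    apply: (mul_unitarymx _ uU); apply: mul_unitarymx; first by rewrite trmxC_unitary.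
    apply/unitarymxP; rewrite tr_diag_mx map_diag_mx mulmx_diag -diag_const_mx.
    have -> : \row_i ((\row_i0 expi (s * t i0)) 0 i
        * (map_mx Num.conj (\row_i0 expi (s * t i0))) 0 i) = const_mx 1.
      by apply/rowP => i; rewrite !mxE expi_normK.
    by [].
  rewrite !det_mulmx mulrAC -det_mulmx UU' det1 mul1r det_diag.
  transitivity (expi (\sum_i s * t i)); last by rewrite -mulr_sumr st mulr0 expi0.
  by rewrite expi_sum; apply: eq_bigr => i _; rewrite mxE.
have hD : mderive (fun s : R => diag_mx (\row_i expi (s * t i)))
    (diag_mx (\row_i (0 +i* t i : C))).
  move=> i j; rewrite !mxE (_ : (fun _ => _) = fun s => expi (s * t i) *+ (i == j)).
    case: (i == j); rewrite ?mulr1n ?mulr0n; first exact: cderive_expi.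
    exact: cderive_cst.
  by apply/funext => s; rewrite !mxE.
have h := mderiveM (mderiveM (mderive_cst (U^t*)) hD) (mderive_cst U).
rewrite mul0mx add0r mulmx0 addr0 -eX in h.
by apply: (mderive_ext _ h) => s; rewrite E.
Qed.

End ExpSU.

(** * The standard twist and its bracket *)
Section StdTwist.
Variables (R : realType) (n : nat).
Local Notation C := R[i].
Local Notation Re := complex.Re.
Local Notation Im := complex.Im.
Local Notation M := 'M[R[i]]_n.

Lemma retrD (A B : M) : retr (A + B) = retr A + retr B.
Proof. by rewrite /retr raddfD ReD. Qed.
Lemma retrN (A : M) : retr (- A) = - retr A.
Proof. by rewrite /retr raddfN ReN. Qed.
Lemma retrB (A B : M) : retr (A - B) = retr A - retr B.
Proof. by rewrite retrD retrN. Qed.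
Lemma retrZ (a : R) (A : M) : retr (a%:C *: A) = a * retr A.
Proof. by rewrite /retr mxtraceZ ReM /= mul0r subr0. Qed.
Lemma retr_mulC (A B : M) : retr (A *m B) = retr (B *m A).
Proof. by rewrite /retr mxtrace_mulC. Qed.

Lemma retr_trmxC (A : M) : retr (A^t*) = retr A.
Proof.
rewrite /retr -[RHS]ReC /mxtrace rmorph_sum.
by congr (Re _); apply: eq_bigr => i _; rewrite !mxE.
Qed.

Lemma mxtrace_delta (A : M) k l : \tr (A *m delta_mx k l) = A l k.
Proof.
rewrite /mxtrace (bigD1 l) //= big1 => [|i il]; rewrite ?addr0 !mxE.
  rewrite (bigD1 k) //= big1 => [|j jk]; rewrite !mxE ?eqxx ?mulr1 ?addr0 //.
  by rewrite (negPf jk) mulr0.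
by rewrite big1 // => j _; rewrite !mxE (negPf il) andbF mulr0.
Qed.

Lemma linform_retr (l : linform R n) : exists L : M, forall A : M, l A = retr (L *m A).
Proof.
exists (\matrix_(j, i) (l (delta_mx i j : M) +i* - l ('i%C *: delta_mx i j : M))) => A.
have eA : (A : cmx R n) = \sum_i \sum_j ((Re (A i j) *: (delta_mx i j : cmx R n)) +
    (Im (A i j) *: ('i%C *: (delta_mx i j : M) : cmx R n))).
  rewrite [LHS](matrix_sum_delta (A : M)); apply: eq_bigr => i _.
  apply: eq_bigr => j _.
  change (A i j *: (delta_mx i j : M) =
    (Re (A i j))%:C *: delta_mx i j + (Im (A i j))%:C *: ('i%C *: delta_mx i j)).
  rewrite scalerA -scalerDl; congr (_ *: _).
  by apply: cplx_ext; rewrite ?(ReD, ImD, ReM, ImM) /=; ring.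
rewrite {1}eA linear_sum /retr /mxtrace.
rewrite (big_morph _ (@ReD R) (erefl _)).
under [RHS]eq_bigr do rewrite mxE (big_morph _ (@ReD R) (erefl _)).
rewrite exchange_big /=; apply: eq_bigr => i _; rewrite linear_sum.
apply: eq_bigr => j _; rewrite linearD !linearZ !mxE ReM /=.
by rewrite /GRing.scale /=; ring.
Qed.

End StdTwist.

Section TwistVector.
Variables (R : realType) (n : nat).
Local Notation C := R[i].
Local Notation Re := complex.Re.
Local Notation Im := complex.Im.
Local Notation M := 'M[R[i]]_n.

Definition kap : R := (4 * n%:R)^-1.

Definition tr_form (A : M) : su R n -> R := fun X => retr (A *m (su_val X : M)).

Lemma tr_formD A X Y : tr_form A (X + Y) = tr_form A X + tr_form A Y.
Proof. by rewrite /tr_form su_valD mulmxDr retrD. Qed.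
Lemma tr_formZ A a X : tr_form A (a *: X) = a * tr_form A X.
Proof. by rewrite /tr_form su_valZ -scalemxAr retrZ. Qed.
Lemma tr_formN A X : tr_form A (- X) = - tr_form A X.
Proof. by rewrite -scaleN1r tr_formZ mulN1r. Qed.
Lemma tr_form0 A : tr_form A 0 = 0.
Proof. by rewrite -(scale0r (0 : su R n)) tr_formZ mul0r. Qed.
Lemma tr_form_sum A (I : Type) (s : seq I) (P : pred I) (F : I -> su R n) :
  tr_form A (\sum_(i <- s | P i) F i) = \sum_(i <- s | P i) tr_form A (F i).
Proof. by apply: (big_morph _ (tr_formD A)); exact: tr_form0. Qed.

Fact twist_vec_key : unit. Proof. by []. Qed.
Definition twist_vec (al : su R n -> R) : su R n := locked_with twist_vec_key
  (kap *: \sum_(i < n) \sum_(j < n | (i < j)%N)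
    (al (Xsu R i j) *: Ysu R i j - al (Ysu R i j) *: Xsu R i j)).

Lemma std_twistE al A : std_twist al (tr_form A) = tr_form A (twist_vec al).
Proof.
rewrite /twist_vec unlock tr_formZ tr_form_sum /std_twist; congr (_ * _).
apply: eq_bigr => i _; rewrite tr_form_sum; apply: eq_bigr => j _.
by rewrite tr_formD tr_formN !tr_formZ.
Qed.

Lemma std_twistC (al be : su R n -> R) : std_twist al be = - std_twist be al.
Proof.
rewrite /std_twist -mulrN -sumrN; congr (_ * _); apply: eq_bigr => i _.
by rewrite -sumrN; apply: eq_bigr => j _; rewrite /wedge; ring.
Qed.

Lemma sum_lt_delta (u : 'I_n -> 'I_n -> C) k l :
  \sum_(i < n) \sum_(j < n | (i < j)%N) ((k == i) && (l == j))%:R * u i j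
  = (k < l)%N%:R * u k l.
Proof.
rewrite (bigD1 k) //= [X in _ + X]big1 ?addr0 => [|i ik]; last first.
  by rewrite big1 // => j _; rewrite eq_sym (negPf ik) mul0r.
case: ltnP => kl.
  rewrite (bigD1 l) //= big1 ?addr0 ?eqxx // => j /andP[_ jl].
  by rewrite (eq_sym l) (negPf jl) andbF mul0r.
rewrite mul0r big1 // => j kj; case: (eqVneq l j) => [lj|_]; last by rewrite andbF mul0r.
by move: kj; rewrite -lj ltnNge kl.
Qed.

Lemma twist_vecE (A : M) : (su_val (twist_vec (tr_form A)) : M) =
  (0 +i* - kap) *: tri_sgn (A - A^t*).
Proof.
have e (a b : R) (X Y : su R n) :
  (su_val (a *: X - b *: Y) : M) = a%:C *: (su_val X : M) - b%:C *: (su_val Y : M) by [].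
rewrite /twist_vec unlock su_valZ.
have -> : (su_val (\sum_(i < n) \sum_(j < n | (i < j)%N)
    (tr_form A (Xsu R i j) *: Ysu R i j - tr_form A (Ysu R i j) *: Xsu R i j)) : M)
  = \sum_(i < n) \sum_(j < n | (i < j)%N)
    ((tr_form A (Xsu R i j))%:C *: ('i%C *: (delta_mx i j + delta_mx j i : M))
     - (tr_form A (Ysu R i j))%:C *: (delta_mx i j - delta_mx j i : M)).
  rewrite (big_morph (fun X : su R n => (su_val X : M)) (@su_valD R n) (erefl _)).
  apply: eq_bigr => i _.
  rewrite (big_morph (fun X : su R n => (su_val X : M)) (@su_valD R n) (erefl _)).
  apply: eq_bigr => j ij.
  have neq : i != j by apply: contraTneq ij => ->; rewrite ltnn.
  by rewrite e XsuE // YsuE.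
pose x (i j : 'I_n) := Re (A j i) - Re (A i j).
pose y (i j : 'I_n) := - (Im (A j i) + Im (A i j)).
have xE (i j : 'I_n) : (i < j)%N -> tr_form A (Xsu R i j) = x i j.
  move=> ij; have neq : i != j by apply: contraTneq ij => ->; rewrite ltnn.
  rewrite /tr_form XsuE // /Xmx /retr (_ : A *m _ = A *m delta_mx i j - A *m delta_mx j i).
    by rewrite raddfB /= !mxtrace_delta ReD ReN.
  exact: mulmxBr.
have yE (i j : 'I_n) : (i < j)%N -> tr_form A (Ysu R i j) = y i j.
  move=> ij; have neq : i != j by apply: contraTneq ij => ->; rewrite ltnn.
  rewrite /tr_form YsuE // /Ymx /retr -scalemxAr mulmxDr mxtraceZ raddfD /=.
  by rewrite !mxtrace_delta ReM ImD /= /y; ring.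
apply/matrixP => k l; rewrite mxE summxE.
transitivity (kap%:C * ((k < l)%N%:R * ('i%C * (x k l)%:C - (y k l)%:C)
   + (l < k)%N%:R * ('i%C * (x l k)%:C + (y l k)%:C))).
  congr (_ * _); rewrite -(sum_lt_delta (fun k l => 'i%C * (x k l)%:C - (y k l)%:C)).
  rewrite -(sum_lt_delta (fun k l => 'i%C * (x k l)%:C + (y k l)%:C)).
  rewrite -big_split /=; apply: eq_bigr => i _; rewrite summxE -big_split /=.
  apply: eq_bigr => j ij; rewrite xE // yE // !mxE [(l == i) && _]andbC; ring.
rewrite !mxE /ord_sgn /x /y; move: (A k l) (A l k) => [a b] [c d].
case: (ltngtP k l) => _; rewrite ?(mul0r, mul1r, mulr0, subrr, subr0, sub0r, addr0, add0r) //.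
  by apply: cplx_ext => /=; ring.
by apply: cplx_ext => /=; ring.
Qed.

End TwistVector.

Section TwistBracket.
Variables (R : realType) (n : nat).
Local Notation C := R[i].
Local Notation M := 'M[R[i]]_n.
Local Notation tv A := (su_val (twist_vec (tr_form A)) : 'M[R[i]]_n).
Local Notation kap := (kap R n).

Lemma trmxC_lbr (A B : M) : (lbr A B)^t* = lbr (B^t*) (A^t*).
Proof. by rewrite /lbr linearB map_mxB !trmxC_mul. Qed.

Lemma lbr_su (X Y : su R n) : (su_val (lie X Y) : M) = lbr (su_val X) (su_val Y).
Proof. by []. Qed.

Lemma retr_lbrr (A B D : M) :
  retr (A *m lbr B D) = retr (A *m B *m D) - retr (A *m D *m B).
Proof. by rewrite /lbr mulmxBr retrB !mulmxA. Qed.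

Lemma retr_su (A : M) (Z : su R n) :
  retr (A *m (su_val Z : M)) = 2^-1 * retr ((A - A^t*) *m (su_val Z : M)).
Proof.
rewrite mulmxBl retrB -[retr (A^t* *m _)]retr_trmxC trmxC_mul trmxCK su_trmxC.
by rewrite mulNmx retrN retr_mulC; field.
Qed.

Lemma retr_tri_sgn_mCYBE (A B D : M) :
  retr (A *m lbr (tri_sgn B) (tri_sgn D)) + retr (B *m lbr (tri_sgn D) (tri_sgn A))
    + retr (D *m lbr (tri_sgn A) (tri_sgn B)) = - retr (D *m lbr A B).
Proof.
have := congr1 (@complex.Re R) (tr_tri_sgn_mCYBE A B D).
by rewrite ReD ReD ReN.
Qed.

Lemma twist_vec_cycle (A B D Ah Bh Dh : M) :
  A - A^t* = Ah -> B - B^t* = Bh -> D - D^t* = Dh ->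
  retr (A *m lbr (tv B) (tv D)) + retr (B *m lbr (tv D) (tv A))
    + retr (D *m lbr (tv A) (tv B)) = kap ^+ 2 / 2 * retr (Dh *m lbr Ah Bh).
Proof.
move=> <- <- <-.
have e (X Y Z : M) : retr (X *m lbr (tv Y) (tv Z)) = - (kap ^+ 2 / 2) *
    retr ((X - X^t*) *m lbr (tri_sgn (Y - Y^t*)) (tri_sgn (Z - Z^t*))).
  rewrite [LHS](retr_su X (lie (twist_vec (tr_form Y)) (twist_vec (tr_form Z)))).
  rewrite lbr_su !twist_vecE; 
  move: (tri_sgn (Y - _)) (tri_sgn (Z - _)) (X - _) => Y' Z' X'.
  have -> : lbr ((0 +i* - kap) *: Y') ((0 +i* - kap) *: Z') =
      (- kap ^+ 2)%:C *: lbr Y' Z'.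
    rewrite /lbr -!scalemxAl -!scalemxAr !scalerA -scalerBr; congr (_ *: _).
    by apply: cplx_ext; rewrite ?(ReM, ImM) /=; ring.
  by rewrite -scalemxAr retrZ; field.
have sum3 (c x y z x' y' z' w : R) : x = - c * x' -> y = - c * y' -> z = - c * z' ->
    x' + y' + z' = - w -> x + y + z = c * w.
  by move=> -> -> -> h; rewrite -2!mulrDr h mulrNN.
exact: sum3 (e _ _ _) (e _ _ _) (e _ _ _) (retr_tri_sgn_mCYBE _ _ _).
Qed.

Lemma curve_differential (P W : Type) (S : set P) (x : P -> W -> R) (f : P -> R) p v c :
  (exists g, curve_at S x p v g) ->
  (forall g, curve_at S x p v g -> is_derive (0 : R) (1 : R) (f \o g) c) ->
  differential S x f p v = c.
Proof.
move=> [g hg] h; rewrite /differential; case: xgetP => [d _ [g' hg' hd]|no].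
  exact: is_derive_uniq hd (h _ hg').
by case: (no c); exists g => //; apply: h.
Qed.

Lemma retr_mul_linear (B : M) : linear (fun A : cmx R n => retr (B *m (A : M)) : R^o).
Proof.
move=> a A A'; change (retr (B *m (a%:C *: (A : M) + (A' : M)))
  = a * retr (B *m (A : M)) + retr (B *m (A' : M))).
by rewrite mulmxDr -scalemxAr retrD retrZ.
Qed.

Definition retr_linform (B : M) : linform R n :=
  HB.pack (fun A : cmx R n => retr (B *m (A : M)) : R^o)
    (GRing.isLinear.Build R (cmx R n) R^o *:%R _ (retr_mul_linear B)).

Lemma mderive_retrP (A : R -> M) D :
  (forall B : M, is_derive (0 : R) (1 : R) (fun s => retr (B *m A s)) (retr (B *m D))) ->
  mderive A D.
Proof.
have re (X : M) i j : complex.Re (X i j) = retr (delta_mx j i *m X).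
  by rewrite retr_mulC /retr mxtrace_delta.
have im (X : M) i j : complex.Im (X i j) = retr ((- 'i%C *: delta_mx j i) *m X).
  by rewrite retr_mulC /retr -scalemxAr mxtraceZ mxtrace_delta ReM /=; ring.
move=> h i j; split.
  by rewrite re; apply: (is_derive_eqfun _ (h _)) => s; rewrite re.
by rewrite im; apply: (is_derive_eqfun _ (h _)) => s; rewrite im.
Qed.

Lemma mderiveD p q (A B : R -> 'M[C]_(p, q)) D E : mderive A D -> mderive B E ->
  mderive (fun s => A s + B s) (D + E).
Proof.
move=> hA hB i j; rewrite !mxE (_ : (fun _ => _) = fun s => A s i j + B s i j).
  exact: cderiveD.
by apply/funext => s; rewrite mxE.
Qed.

Lemma mderiveB p q (A B : R -> 'M[C]_(p, q)) D E : mderive A D -> mderive B E ->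
  mderive (fun s => A s - B s) (D - E).
Proof.
move=> hA hB; rewrite -scaleN1r.
by apply: mderive_ext (mderiveD hA (mderiveZ (-1) hB)) => s; rewrite scaleN1r.
Qed.

Lemma mderive_tri_sgn (A : R -> M) D : mderive A D ->
  mderive (fun s => tri_sgn (A s)) (tri_sgn D).
Proof.
move=> hA i j; rewrite !mxE (_ : (fun _ => _) = fun s => ord_sgn _ i j * A s i j).
  by have := cderiveM (cderive_cst (ord_sgn C i j)) (hA i j); rewrite mul0r add0r.
by apply/funext => s; rewrite mxE.
Qed.

Lemma mderive_twist_vec (A : R -> M) D : mderive A D ->
  mderive (fun s => tv (A s)) (tv D).
Proof.
move=> hA; rewrite twist_vecE.
apply: (mderive_ext (fun s => esym (twist_vecE (A s)))).
by apply/mderiveZ/mderive_tri_sgn/mderiveB/mderive_trmxC.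
Qed.

Lemma retr_twist_vecC (A B : M) : retr (B *m tv A) = - retr (A *m tv B).
Proof.
have := std_twistC (tr_form A) (tr_form B).
by rewrite !std_twistE.
Qed.

Lemma mderive_std_twist (A B : R -> M) D E : mderive A D -> mderive B E ->
  is_derive (0 : R) (1 : R) (fun s => std_twist (tr_form (A s)) (tr_form (B s)))
   (retr (E *m tv (A 0)) - retr (D *m tv (B 0))).
Proof.
move=> hA hB; rewrite -retr_twist_vecC -retrD.
have h := mderive_retr (mderiveM hB (mderive_twist_vec hA)).
by apply: (is_derive_eqfun _ h) => s; rewrite std_twistE.
Qed.

Lemma left_invE (l m : linform R n) L L' g : (forall A : M, l A = retr (L *m A)) ->
  (forall A : M, m A = retr (L' *m A)) ->
  left_inv (@std_twist R n) g l m = std_twist (tr_form (L *m g)) (tr_form (L' *m g)).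
Proof.
move=> hl hm; rewrite /left_inv; congr (std_twist _ _); apply/funext => X.
  by rewrite hl mulmxA.
by rewrite hm mulmxA.
Qed.

Lemma SU1 : SU (1%:M : M).
Proof.
by split; [apply/unitarymxP; rewrite trmx1 map_mx1 mulmx1 | rewrite det1].
Qed.

Lemma SU_curve (Z : su R n) : exists g, curve_at (@SU R n)
  (fun g (l : linform R n) => l (g : cmx R n)) (1%:M : M) (fun l => l (su_val Z)) g.
Proof.
have [hS h0 hd] := mexp_su Z; exists (fun s => mexp (su_val (s *: Z))).
split=> // l; have [L hL] := linform_retr l; rewrite hL.
have h := mderive_retr (mderiveM (mderive_cst L) hd).
rewrite mul0mx add0r in h.
by apply: (is_derive_eqfun _ h) => s; rewrite hL.
Qed.

Lemma left_inv_differential (l m k : linform R n) L L' K :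
  (forall A : M, l A = retr (L *m A)) -> (forall A : M, m A = retr (L' *m A)) ->
  (forall A : M, k A = retr (K *m A)) ->
  differential (@SU R n) (fun g (l : linform R n) => l (g : cmx R n))
    (fun q => left_inv (@std_twist R n) q l m) (1%:M : M)
    (sharp (left_inv (@std_twist R n)) 1%:M k) =
  retr (L' *m tv K *m tv L) - retr (L *m tv K *m tv L').
Proof.
move=> hl hm hk.
have -> : sharp (left_inv (@std_twist R n)) 1%:M k = fun b => b (tv K : cmx R n).
  apply/funext => b; have [B hB] := linform_retr b.
  by rewrite /sharp (left_invE _ hk hB) !mulmx1 std_twistE hB.
apply: curve_differential; first exact: SU_curve.
move=> g [gS g0 gd].
have hg : mderive g (tv K).
  by apply: mderive_retrP => B; exact: (gd (retr_linform B)).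
have hL := mderiveM (mderive_cst L) hg; have hL' := mderiveM (mderive_cst L') hg.
have h := mderive_std_twist hL hL'; rewrite !mul0mx !add0r g0 !mulmx1 in h.
by apply: (is_derive_eqfun _ h) => s /=; rewrite (left_invE _ hl hm).
Qed.

Lemma twist_bracketE (l m k : linform R n) L L' K Lh Lh' Kh :
  (forall A : M, l A = retr (L *m A)) -> (forall A : M, m A = retr (L' *m A)) ->
  (forall A : M, k A = retr (K *m A)) ->
  L - L^t* = Lh -> L' - L'^t* = Lh' -> K - K^t* = Kh ->
  twist_bracket (@std_twist R n) l m k = kap ^+ 2 * retr (Kh *m lbr Lh Lh').
Proof.
move=> hl hm hk <- <- <-.
rewrite /twist_bracket /schouten /schouten_term.
rewrite (left_inv_differential hl hm hk) (left_inv_differential hm hk hl).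
rewrite (left_inv_differential hk hl hm).
have sum6 (x y z a b c a' b' c' c2 w : R) : x + y + z = c2 / 2 * w ->
    x = a - a' -> y = b - b' -> z = c - c' ->
    b - a' + (b - a') + (c - b' + (c - b')) + (a - c' + (a - c')) = c2 * w.
  by move=> h hx hy hz; move: h; rewrite hx hy hz; lra.
exact: sum6 (twist_vec_cycle (erefl _) (erefl _) (erefl _))
  (retr_lbrr _ _ _) (retr_lbrr _ _ _) (retr_lbrr _ _ _).
Qed.

Lemma retr_lbr_invariant (c : R) (A B D Z : M) :
  c * retr (D *m lbr (lbr A Z) B) + c * retr (D *m lbr A (lbr B Z))
    + c * retr (lbr D Z *m lbr A B) = 0.
Proof.
have := congr1 (@complex.Re R) (tr_lbr_invariant A B D Z).
by rewrite 2!ReD => h; rewrite -2!mulrDr [X in c * X]h mulr0.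
Qed.

Lemma lbr_subr_trmxC (B : M) (Z : su R n) :
  lbr B (su_val Z) - (lbr B (su_val Z))^t* = lbr (B - B^t*) (su_val Z).
Proof.
rewrite trmxC_lbr su_trmxC /lbr mulNmx mulmxN mulmxBl mulmxBr.
by rewrite opprB opprD !opprK addrACA.
Qed.

Lemma rmatrix_std_twist : rmatrix (@std_twist R n).
Proof.
move=> Z l m k; have [L hL] := linform_retr l; have [L' hL'] := linform_retr m.
have [K hK] := linform_retr k.
have adE (f : linform R n) (B : M) : (forall A : M, f A = retr (B *m A)) ->
    forall A : M, (f \o ad Z) A = retr (lbr B (su_val Z) *m A).
  move=> hf A /=; rewrite [ad Z A]/(lbr (su_val Z) A) hf /lbr mulmxBl mulmxBr !retrB.
  by rewrite !mulmxA; congr (_ - _); rewrite retr_mulC mulmxA.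
rewrite (twist_bracketE (adE _ _ hL) hL' hK (lbr_subr_trmxC L Z) (erefl _) (erefl _)).
rewrite (twist_bracketE hL (adE _ _ hL') hK (erefl _) (lbr_subr_trmxC L' Z) (erefl _)).
rewrite (twist_bracketE hL hL' (adE _ _ hK) (erefl _) (erefl _) (lbr_subr_trmxC K Z)).
exact: retr_lbr_invariant.
Qed.
End TwistBracket.

(** * Functionals with stabilizer S(U(r) x U(n-r)) *)
Section Xi0.
Variables (R : realType) (n : nat).
Local Notation C := R[i].
Local Notation M := 'M[R[i]]_n.

Definition su_proj (A : M) : M :=
  2^-1 *: (A - A^t*) - ((2^-1 * \tr (A - A^t*)) / n%:R)%:M.

Lemma mxtrace_trmxC (A : M) : \tr (A^t*) = Num.conj (\tr A).
Proof. by rewrite /mxtrace rmorph_sum; apply: eq_bigr => i _; rewrite !mxE. Qed.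

Lemma su_proj_in (n0 : (0 < n)%N) (A : M) : (su_proj A : cmx R n) \in in_su (n := n).
Proof.
apply/in_suP; split.
  apply/matrixP => i j; rewrite !mxE rmorphB rmorphM rmorphB /= conjCK.
  rewrite rmorphMn !rmorphM /= !rmorphV ?unitfE ?pnatr_eq0 // ?lt0n_neq0 //.
  rewrite !rmorph_nat raddfB /= mxtrace_trmxC rmorphB /= conjCK eq_sym.
  by case: eqP => _; rewrite ?mulr0n ?mulr1n; ring.
rewrite /su_proj [\tr _]raddfB /= mxtraceZ mxtrace_scalar.
by rewrite -[_ *+ n]mulr_natr divfK ?subrr // pnatr_eq0 -lt0n.
Qed.


Lemma su_proj_id (X : su R n) : su_proj (su_val X) = su_val X.
Proof.
rewrite /su_proj su_trmxC opprK mxtraceD.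
rewrite su_tr addr0 mulr0 mul0r raddf0 subr0.
by apply/matrixP => i j; rewrite !mxE; field.
Qed.

Lemma su_proj_linear (a : R) (A B : M) :
  su_proj (a%:C *: A + B) = a%:C *: su_proj A + su_proj B.
Proof.
have conja : Num.conj (a%:C : C) = a%:C by apply: cplx_ext; rewrite /= ?oppr0.
have e : (a%:C *: A + B)^t* = a%:C *: A^t* + B^t*.
  by apply/matrixP => i j; rewrite !mxE rmorphD rmorphM /= conja.
have e2 : a%:C *: A + B - (a%:C *: A^t* + B^t*) = a%:C *: (A - A^t*) + (B - B^t*).
  by rewrite scalerBr opprD addrACA.
rewrite /su_proj e e2 (mxtraceD (a%:C *: _)) mxtraceZ.
by apply/matrixP => i j; rewrite !mxE; case: eqP => _; rewrite ?mulr0n ?mulr1n; ring.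
Qed.

Lemma retr_su_proj (A : M) (X : su R n) : retr (su_proj A *m su_val X) = retr (A *m su_val X).
Proof.
rewrite /su_proj mulmxBl retrB [RHS]retr_su.
rewrite [X in _ - X](_ : _ = 0) ?subr0; last first.
  by rewrite mul_scalar_mx /retr mxtraceZ su_tr mulr0.
have -> : (2^-1 : C) = (2^-1 : R)%:C by rewrite fmorphV rmorph_nat.
by rewrite -scalemxAl retrZ.
Qed.

Lemma su_ext (X Y : su R n) : (0 < n)%N ->
  (forall Z : su R n, retr ((su_val X : M) *m su_val Z) =
    retr ((su_val Y : M) *m su_val Z)) -> X = Y.
Proof.
move=> n0 h; apply: val_inj => /=.
have hB (B : M) : retr ((su_val X : M) *m B) = retr ((su_val Y : M) *m B).
  have := h (Su (su_proj_in n0 B)); rewrite /= ![retr (_ *m su_proj B)]retr_mulC.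
  by rewrite !retr_su_proj ![retr (B *m _)]retr_mulC.
apply/matrixP => i j.
have := hB (delta_mx j i); have := hB (- 'i%C *: delta_mx j i).
rewrite -!scalemxAr /retr !mxtraceZ !mxtrace_delta => h1 h2.
by apply: cplx_ext => //; move: h1; rewrite !ReM /=; lra.
Qed.

Lemma diag_su_char (a b : 'I_n) : a != b ->
  SU (diag_mx (\row_i (if i == a then 'i%C else if i == b then - 'i%C else 1 : C))).
Proof.
move=> ab; split.
  apply/unitarymxP; rewrite tr_diag_mx map_diag_mx mulmx_diag -diag_const_mx.
  congr diag_mx; apply/rowP => i; rewrite !mxE.
  case: eqP => _; first by apply: cplx_ext; rewrite ?(ReM, ImM) /=; ring.
  case: eqP => _; by apply: cplx_ext; rewrite ?(ReM, ImM) /=; ring.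
rewrite det_diag (bigD1 a) //= (bigD1 b) /= 1?eq_sym // big1 => [|i /andP[ia ib]].
  rewrite !mxE !eqxx eq_sym (negPf ab).
  by apply: cplx_ext; rewrite ?(ReM, ImM) /=; ring.
by rewrite !mxE (negPf ia) (negPf ib).
Qed.

Lemma swap_su (a b : 'I_n) : a != b -> exists k : M, [/\ SU k, k a b = 1 &
  forall i j, k i j != 0 -> [|| i == j, (i == a) && (j == b) | (i == b) && (j == a)]].
Proof.
move=> ab; set d : 'rV[C]_n := \row_i (if i == b then -1 else 1).
exists (diag_mx d *m tperm_mx a b).
have kE i j : (diag_mx d *m tperm_mx a b) i j = d 0 i * (tperm a b i == j)%:R.
  by rewrite mul_diag_mx !mxE.
split.
- split.
    apply: mul_unitarymx; apply/unitarymxP.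
      rewrite tr_diag_mx map_diag_mx mulmx_diag -diag_const_mx.
      congr diag_mx; apply/rowP => i; rewrite !mxE; case: eqP => _.
        by rewrite rmorphN rmorph1 mulrNN mulr1.
      by rewrite rmorph1 mulr1.
    by rewrite /tperm_mx tr_perm_mx map_perm_mx -perm_mxM mulgV perm_mx1.
  rewrite det_mulmx det_diag /tperm_mx det_perm odd_tperm ab expr1.
  rewrite (bigD1 b) //= big1 => [|i ib]; rewrite !mxE ?eqxx ?(negPf ib) //.
  by rewrite mulr1 mulrNN mulr1.
- by rewrite kE !mxE (negPf ab) tpermL eqxx mulr1.
move=> i j; rewrite kE; case: tpermP => [->|->|] /=; rewrite ?eqxx.
- by case: (eqVneq b j) => [->|_]; rewrite ?eqxx ?orbT // mulr0 eqxx.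
- by case: (eqVneq a j) => [->|_]; rewrite ?eqxx ?orbT // mulr0 eqxx.
by case: (eqVneq i j) => // _ _ _; rewrite mulr0 eqxx.
Qed.

End Xi0.

Section OrbitForm.
Variables (R : realType) (n : nat).
Local Notation C := R[i].
Local Notation M := 'M[R[i]]_n.

Lemma su_linear_retr (n0 : (0 < n)%N) (xi : {linear su R n -> R^o}) :
  exists L : su R n, forall X, xi X = retr ((su_val L : M) *m su_val X).
Proof.
pose f (A : cmx R n) : R^o := xi (Su (su_proj_in n0 A)).
have f_linear : linear f.
  move=> a A B; rewrite /f -linearP; congr (xi _); apply: val_inj.
  exact: (su_proj_linear a A B).
pose l : linform R n := HB.pack f (GRing.isLinear.Build R (cmx R n) R^o *:%R f f_linear).
have [L hL] := linform_retr l.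
exists (Su (su_proj_in n0 L)) => X; rewrite /= retr_su_proj -hL.
by congr (xi _); apply: val_inj; rewrite /= su_proj_id.
Qed.

Lemma retr_Ad (L X : su R n) (g : M) : SU g ->
  retr ((su_val (Ad g L) : M) *m su_val X) = retr ((su_val L : M) *m su_val (Ad (invmx g) X)).
Proof.
move=> gS; rewrite !AdE //; last exact: SUV.
by rewrite invmxK -!mulmxA retr_mulC !mulmxA.
Qed.

(* The matrix representing xi commutes with the stabilizer: elements
   diag(.., i, .., -i, ..) make it diagonal, and signed transpositions inside a
   block make it constant on that block.  If the two constants agreed, the
   stabilizer would be the whole group. *)
Lemma stabilizer_form (r : nat) (xi : {linear su R n -> R^o}) :
  (0 < r)%N -> (r < n)%N -> stabilizer_is r xi ->
  exists eta : C, [/\ eta != 0, Num.conj eta = - eta &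
    forall X : su R n, xi X = retr (eta *: pid_mx r *m (su_val X : M))].
Proof.
move=> r0 rn st; have n0 : (0 < n)%N by apply: leq_trans rn.
have [L hL] := su_linear_retr n0 xi.
have comm (k : M) : SUU r k -> k *m (su_val L : M) = (su_val L : M) *m k.
  move=> kU; have [kS _] := kU; have fixk := (st k kS).2 kU.
  have e : Ad k L = L.
    apply: su_ext => // Z; rewrite retr_Ad // -!hL.
    exact: (congr1 (fun f => f Z) fixk).
  by have := AdE L kS; rewrite e => {2}->; rewrite mulmxKV // SU_unit.
have off a b : a != b -> (su_val L : M) a b = 0.
  move=> ab; set d := \row_i (if i == a then 'i%C else if i == b then - 'i%C else 1 : C).
  have dU : SUU r (diag_mx d).
    split; first exact: diag_su_char.
    by move=> i j; rewrite !mxE; case: (eqVneq i j) => [->|]; rewrite ?eqxx.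
  have := congr1 (fun B : M => B a b) (comm _ dU).
  rewrite mul_diag_mx mul_mx_diag !mxE !eqxx eq_sym (negPf ab) => /eqP.
  rewrite [X in _ == X]mulrC -subr_eq0 -mulrBl mulf_eq0 opprK => /orP[|/eqP//].
  by move=> /eqP/(congr1 (@complex.Im R)) /= /eqP; rewrite -mulr2n mulrn_eq0 oner_eq0.
have diagk (k : M) a b : SUU r k -> k a b != 0 -> (su_val L : M) a a = (su_val L : M) b b.
  move=> kU kab; have := congr1 (fun B : M => B a b) (comm _ kU).
  rewrite !mxE (bigD1 b) //= big1 => [|i ib]; last by rewrite off ?mulr0 // eq_sym.
  rewrite [in X in _ = X](bigD1 a) //= big1 => [|i ia]; last by rewrite off ?mul0r // eq_sym.
  by rewrite !addr0 mulrC => /(mulIf kab).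
have block (a b : 'I_n) : (a < r)%N = (b < r)%N -> (su_val L : M) a a = (su_val L : M) b b.
  move=> ab; case: (eqVneq a b) => [-> //|neq].
  have [k [kS kab ksupp]] := swap_su R neq.
  apply: (diagk k); last by rewrite kab oner_eq0.
  split=> // i j; apply: contraNeq => /ksupp.
  move=> /or3P[/eqP->//|/andP[/eqP-> /eqP->]|/andP[/eqP-> /eqP->]].
    by rewrite ab.
  by rewrite ab.
pose a0 : 'I_n := Ordinal n0; pose b0 : 'I_n := Ordinal rn.
set y := (su_val L : M) b0 b0; set eta := (su_val L : M) a0 a0 - y.
have eL : (su_val L : M) = eta *: pid_mx r + y%:M.
  apply/matrixP => i j; rewrite !mxE (_ : (i == j :> nat) = (i == j)) //.
  case: (eqVneq i j) => [<-|ij]; last by rewrite off // mulr0 addr0.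
  rewrite mulr1n /=; case: ltnP => ir; rewrite ?mulr1 ?mulr0 ?add0r.
    by rewrite subrK; apply: block; rewrite /= ir r0.
  by apply: block; rewrite /= ltnn ltnNge ir.
have xiE X : xi X = retr (eta *: pid_mx r *m (su_val X : M)).
  by rewrite hL eL mulmxDl retrD mul_scalar_mx [X in _ + X]/retr mxtraceZ su_tr mulr0 addr0.
have conjL i : Num.conj ((su_val L : M) i i) = - (su_val L : M) i i.
  by have := congr1 (fun B : M => B i i) (su_trmxC L); rewrite !mxE.
exists eta; split=> //; last by rewrite /eta /y rmorphB /= !conjL opprB opprK addrC.
apply/eqP => eta0.
have ab : a0 != b0 by rewrite -val_eqE /= eq_sym -lt0n.
have [k [kS kab _]] := swap_su R ab.
have [_ /(_ a0 b0)] : SUU r k.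
  apply/st => //; apply/funext => X.
  by rewrite /coAd !xiE eta0 scale0r !mul0mx.
by rewrite /= r0 ltnn kab => /(_ isT)/eqP; rewrite oner_eq0.
Qed.
End OrbitForm.

(** * Entrywise norm of complex matrices *)
Section EntryNorm.
Variables (R : realType) (n : nat).
Local Notation C := R[i].
Local Notation M := 'M[R[i]]_n.

Definition entry_norm (A : M) : C := \sum_i \sum_j `|A i j|.
Local Notation N := entry_norm.

Lemma entry_norm_ge0 A : 0 <= N A.
Proof. by apply: sumr_ge0 => i _; apply: sumr_ge0. Qed.

Lemma entry_norm_eq0 A : N A = 0 -> A = 0.
Proof.
move=> /eqP; rewrite psumr_eq0 => [/allP h|i _]; last exact: sumr_ge0.
apply/matrixP => i j; have := h i (mem_index_enum _).
rewrite /= psumr_eq0 // => /allP /(_ j (mem_index_enum _)) /=.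
by rewrite normr_eq0 mxE => /eqP.
Qed.

Lemma entry_normD A B : N (A + B) <= N A + N B.
Proof.
rewrite /N -big_split; apply: ler_sum => i _; rewrite -big_split.
by apply: ler_sum => j _; rewrite mxE ler_normD.
Qed.

Lemma entry_normN A : N (- A) = N A.
Proof. by apply: eq_bigr => i _; apply: eq_bigr => j _; rewrite mxE normrN. Qed.

Lemma entry_normZ a A : N (a *: A) = `|a| * N A.
Proof.
rewrite /N mulr_sumr; apply: eq_bigr => i _; rewrite mulr_sumr.
by apply: eq_bigr => j _; rewrite mxE normrM.
Qed.

Lemma entry_normM A B : N (A *m B) <= N A * N B.
Proof.
have step : N (A *m B) <= \sum_i \sum_k `|A i k| * N B.
  apply: ler_sum => i _.
  apply: (@le_trans _ _ (\sum_j \sum_k `|A i k| * `|B k j|)).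
    apply: ler_sum => j _; rewrite mxE; apply: le_trans (ler_norm_sum _ _ _) _.
    by apply: ler_sum => k _; rewrite normrM.
  rewrite exchange_big; apply: ler_sum => k _; rewrite -mulr_sumr.
  apply: ler_wpM2l => //; rewrite /N [leRHS](bigD1 k) //= lerDl.
  by apply: sumr_ge0 => l _; apply: sumr_ge0.
by apply: le_trans step _; rewrite /N mulr_suml; under eq_bigr do rewrite -mulr_suml.
Qed.

Lemma entry_norm_tri_sgn A : N (tri_sgn A) <= N A.
Proof.
apply: ler_sum => i _; apply: ler_sum => j _; rewrite mxE normrM /ord_sgn.
by case: (ltngtP i j) => _; rewrite ?subr0 ?sub0r ?normrN ?normr1 ?subrr ?normr0 ?mul1r ?mul0r.
Qed.

Lemma entry_norm_lbr A B : N (lbr A B) <= 2 * N A * N B.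
Proof.
rewrite /lbr; apply: le_trans (entry_normD _ _) _; rewrite entry_normN.
rewrite -mulrA mulr2n mulrDl !mul1r; apply: lerD; first exact: entry_normM.
by rewrite mulrC; exact: entry_normM.
Qed.

Lemma entry_norm_unitary (g : M) : g \is unitarymx -> N g <= n%:R * n%:R.
Proof.
move=> /unitarymxP gg.
have le1 i j : `|g i j| <= 1.
  have := congr1 (fun B : M => B i i) gg; rewrite !mxE eqxx => e.
  rewrite -(@ler_pXn2r _ 2) ?nnegrE // expr1n -[X in _ <= X]e.
  rewrite (bigD1 j) //= !mxE -normCK lerDl; apply: sumr_ge0 => k _.
  by rewrite !mxE -normCK exprn_ge0.
apply: (@le_trans _ _ (\sum_(i < n) \sum_(j < n) 1)).
  by apply: ler_sum => i _; apply: ler_sum => j _; apply: le1.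
by rewrite !sumr_const card_ord -[X in X <= _]mulr_natr.
Qed.

Lemma contraction_fixpoint0 (k : R) (z : C) (A B : M) :
  N B <= k%:C * N A -> A = z *: B -> `|z| * k%:C < 1 -> A = 0.
Proof.
move=> hB eA hz; apply: entry_norm_eq0; apply/eqP.
have h : N A <= `|z| * k%:C * N A.
  by rewrite {1}eA entry_normZ -mulrA; apply: ler_wpM2l.
rewrite -subr_ge0 -[X in _ - X]mul1r -mulrBl in h.
rewrite eq_le entry_norm_ge0 andbT; move: h; rewrite -oppr_le0 -mulNr opprB.
by rewrite pmulr_rle0 // subr_gt0.
Qed.

Lemma injective_linear_solve (f : {linear M -> M}) (X : M) :
  (forall A, f A = 0 -> A = 0) -> exists A, f A = X.
Proof.
move=> f0.
have free : lin_mx f \in unitmx.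
  rewrite -row_free_unit; apply: inj_row_free => v; rewrite mul_rV_lin => fv.
  have v0 : vec_mx v = 0 by apply/f0/(can_inj mxvecK); rewrite fv linear0.
  by rewrite -[v]vec_mxK v0 linear0.
exists (vec_mx (mxvec X *m invmx (lin_mx f))).
by rewrite -mx_rV_lin mulmxKV // mxvecK.
Qed.
End EntryNorm.

(** * Polynomials are smooth *)
Section SmoothFunctions.
Variables (R : realType) (N : nat).
Implicit Types F G : 'rV[R]_N -> R.

Lemma Ck_ext F G k : F =1 G -> Ck k F -> Ck k G.
Proof. by move=> /funext ->. Qed.

Lemma Ck_cst (c : R) k : Ck k (fun _ : 'rV[R]_N => c).
Proof.
elim: k c => [|k IH] c /=; first exact: cst_continuous.
split=> [y|v]; first exact: differentiable_cst.
apply: (Ck_ext _ (IH 0)) => y; apply/esym; exact: derive_cst.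
Qed.

Lemma Ck_coord i k : Ck k (fun y : 'rV[R]_N => y ord0 i).
Proof.
case: k => [|k] /=; first exact: coord_continuous.
split=> [y|v]; first exact: differentiable_coord.
apply: (Ck_ext _ (Ck_cst (v ord0 i) k)) => y.
rewrite deriveE; last exact: differentiable_coord.
have f_linear : linear (fun y : 'rV[R]_N => y ord0 i : R) by move=> a u w; rewrite !mxE.
pose fL := HB.pack (fun y : 'rV[R]_N => y ord0 i : R)
  (GRing.isLinear.Build _ _ _ _ _ f_linear) : {linear 'rV[R]_N -> R}.
by have /= -> := @diff_lin _ _ _ fL y (@coord_continuous _ _ _ _ _).
Qed.

Lemma CkD F G k : Ck k F -> Ck k G -> Ck k (fun y => F y + G y).
Proof.
elim: k F G => [|k IH] F G /=.
  by move=> cF cG y; exact: (cvgD (cF y) (cG y)).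
move=> [dF hF] [dG hG]; split=> [y|v]; first exact: differentiableD.
apply: (@Ck_ext (fun y => 'D_v F y + 'D_v G y)).
  by move=> y; apply/esym/deriveD; apply: diff_derivable.
exact: IH.
Qed.

Lemma CkM F G : (forall k, Ck k F) -> (forall k, Ck k G) ->
  forall k, Ck k (fun y => F y * G y).
Proof.
move=> hF hG k; elim: k F G hF hG => [|k IH] F G hF hG /=.
  have cF : continuous F := hF 0%N; have cG : continuous G := hG 0%N.
  by move=> y; exact: (cvgM (cF y) (cG y)).
have [dF _] := hF 1%N; have [dG _] := hG 1%N.
split=> [y|v]; first exact: differentiableM.
apply: (@Ck_ext (fun y => F y * 'D_v G y + G y * 'D_v F y)).
  by move=> y; apply/esym/deriveM; apply: diff_derivable.
by apply: CkD; apply: IH => // j; [have [_] := hG j.+1 | have [_] := hF j.+1]; apply.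
Qed.

Lemma Ck_sum (I : Type) (s : seq I) (P : pred I) (F : I -> 'rV[R]_N -> R) k :
  (forall i, Ck k (F i)) -> Ck k (fun y => \sum_(i <- s | P i) F i y).
Proof.
move=> hF; elim: s => [|i s IH].
  by apply: (Ck_ext _ (Ck_cst 0 k)) => y; rewrite big_nil.
case Pi : (P i).
  by apply: (Ck_ext _ (CkD (hF i) IH)) => y; rewrite big_cons Pi.
by apply: (Ck_ext _ IH) => y; rewrite big_cons Pi.
Qed.
End SmoothFunctions.

(** * The orbit and the deformed bivector *)
Section Orbit.
Variables (R : realType) (n r : nat).
Local Notation C := R[i].
Local Notation M := 'M[R[i]]_n.
Variables (xi0 : {linear su R n -> R^o}) (eta : C).
Hypothesis n0 : (0 < n)%N.
Hypothesis rn : (r <= n)%N.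
Hypothesis st : stabilizer_is r xi0.
Hypothesis eta0 : eta != 0.
Hypothesis conj_eta : Num.conj eta = - eta.
Hypothesis xi0E : forall X : su R n, xi0 X = retr (eta *: pid_mx r *m (su_val X : M)).
Local Notation x := (to_orbit xi0).
Implicit Types p : set M.

Fact orbit_mx_key : unit. Proof. by []. Qed.
Definition orbit_mx (p : set M) : M := locked_with orbit_mx_key
  (xget 1%:M p *m (eta *: pid_mx r) *m invmx (xget 1%:M p)).
Local Notation Q := orbit_mx.

Lemma Gr_xget (p : set M) : Gr r p -> SU (xget 1%:M p).
Proof.
move=> [g gS <-]; case: xgetP => [_ -> [k [kS _] <-]|_]; first exact: SUM.
exact: SU1.
Qed.

Lemma to_orbit_retr p w : Gr r p -> x p w = retr (Q p *m (su_val w : M)).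
Proof.
move=> /Gr_xget; rewrite /to_orbit /Q unlock /coAd; move: (xget _ _) => g gS.
rewrite xi0E AdE; last exact: SUV.
by rewrite invmxK -!mulmxA retr_mulC !mulmxA [RHS]retr_mulC !mulmxA
  [RHS]retr_mulC !mulmxA.
Qed.

Lemma pid_mx_sq : (eta *: pid_mx r : M) *m (eta *: pid_mx r : M) = eta *: (eta *: pid_mx r).
Proof. by rewrite -scalemxAl -scalemxAr pid_mx_id. Qed.

Lemma orbit_mx_sq p : Gr r p -> Q p *m Q p = eta *: Q p.
Proof.
move=> /Gr_xget gS; rewrite /Q unlock mulmx_similar; last by rewrite mulVmx // SU_unit.
by rewrite pid_mx_sq -scalemxAr -scalemxAl.
Qed.

Lemma orbit_mx_trmxC p : Gr r p -> (Q p)^t* = - Q p.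
Proof.
move=> /Gr_xget [gU _]; rewrite /Q unlock invmx_unitary // !trmxC_mul trmxCK mulmxA.
have -> : (eta *: pid_mx r : M)^t* = - (eta *: pid_mx r).
  apply/matrixP => i j; rewrite !mxE rmorphM rmorph_nat /= conj_eta mulNr.
  by case: (eqVneq (i : nat) j) => [->|].
by rewrite mulmxN mulNmx.
Qed.

Lemma mxtrace_orbit_mx p : Gr r p -> \tr (Q p) = \tr (eta *: pid_mx r : M).
Proof.
by move=> /Gr_xget /SU_unit gS; rewrite /Q unlock mxtrace_mulC mulmxA mulVmx ?mul1mx.
Qed.

Lemma lact_coset (g h : M) : lact g (coset r h) = coset r (g *m h).
Proof.
apply/seteqP; split => k /=.
  by case=> _ [l lS <-] <-; exists l; rewrite // mulmxA.
by case=> l lS <-; exists (h *m l); [exists l | rewrite mulmxA].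
Qed.

Lemma coadE (X : su R n) p w : Gr r p ->
  coad X (x p) w = retr (Q p *m lbr (su_val w) (su_val X)).
Proof. by move=> pG; rewrite /coad to_orbit_retr // lbr_su. Qed.

Lemma coad_curve (X : su R n) p : Gr r p ->
  curve_at (Gr r) x p (coad X (x p)) (fun s => lact (mexp (su_val (s *: X))) p).
Proof.
move=> pG; have [hS h0 hd] := mexp_su X; split.
- move=> s; have [g gS <-] := pG; rewrite lact_coset.
  by exists (mexp (su_val (s *: X)) *m g) => //; apply: SUM.
- by have [g gS <-] := pG; rewrite h0 lact_coset mul1mx.
move=> w; rewrite coadE //.
have h := mderive_retr (mderiveM (mderive_cst (Q p))
  (mderiveM (mderiveM (mderive_trmxC hd) (mderive_cst (su_val w : M))) hd)).
rewrite /= !h0 !mul0mx !mulmx0 trmx1 map_mx1 mulmx1 mul1mx add0r addr0 su_trmxC in h.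
rewrite mulNmx addrC in h.
apply: (is_derive_eqfun _ h) => s; have [gU _] := hS s.
rewrite (to_orbit_lact st (hS s) pG) /coAd to_orbit_retr // AdE; last exact: SUV.
by rewrite invmxK invmx_unitary.
Qed.

Lemma fund_coad (X : su R n) p : Gr r p -> fund x X p = coad X (x p).
Proof.
move=> pG; apply/funext => a; have [_ _ h] := coad_curve X pG.
by rewrite /fund derive1E; apply: (@derive_val _ _ _ _ _ _ _ (h a)).
Qed.

Lemma coad_tangent (X : su R n) p : Gr r p -> tangent (Gr r) x p (coad X (x p)).
Proof. by move=> pG; exists (fun s => lact (mexp (su_val (s *: X))) p); apply: coad_curve. Qed.

Lemma retr_orbit_mx p (B : M) : Gr r p ->
  retr (B *m Q p) = x p (Su (su_proj_in n0 B)) +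
   complex.Re ((2^-1 * \tr (B - B^t*)) / n%:R * \tr (eta *: pid_mx r : M)).
Proof.
move=> pG; rewrite to_orbit_retr //= /su_proj mulmxBr retrB mul_mx_scalar.
rewrite {3}/retr mxtraceZ mxtrace_orbit_mx // subrK.
have -> : (2^-1 : C) = (2^-1 : R)%:C by rewrite fmorphV rmorph_nat.
rewrite -scalemxAr retrZ mulmxBr retrB.
have -> : retr (Q p *m B^t*) = - retr (Q p *m B).
  by rewrite -retr_trmxC trmxC_mul trmxCK orbit_mx_trmxC // mulmxN retrN retr_mulC.
by rewrite retr_mulC; field.
Qed.

Lemma mderive_orbit_mx p v g : curve_at (Gr r) x p v g ->
  exists D, mderive (fun s => Q (g s)) D.
Proof.
move=> [gG g0 gd].
exists (\matrix_(i, j) (v (Su (su_proj_in n0 (delta_mx j i))) +i*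
                        v (Su (su_proj_in n0 (- 'i%C *: delta_mx j i))))).
have h B : is_derive (0 : R) (1 : R) (fun s => retr (B *m Q (g s)))
    (v (Su (su_proj_in n0 B))).
  have h := is_deriveD (gd (Su (su_proj_in n0 B))) (is_derive_cst (complex.Re
     ((2^-1 * \tr (B - B^t*)) / n%:R * \tr (eta *: pid_mx r : M))) (0 : R) (1 : R)).
  rewrite addr0 in h; apply: (is_derive_eqfun _ h) => s.
  by rewrite retr_orbit_mx.
move=> i j; rewrite !mxE; split=> /=.
  apply: (is_derive_eqfun _ (h _)) => s.
  by rewrite retr_mulC /retr mxtrace_delta.
apply: (is_derive_eqfun _ (h _)) => s.
by rewrite retr_mulC /retr -scalemxAr mxtraceZ mxtrace_delta ReM /=; ring.
Qed.

Lemma velocity_mx p v g : curve_at (Gr r) x p v g ->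
  exists D, mderive (fun s => Q (g s)) D /\
    forall w, v w = retr (D *m (su_val w : M)).
Proof.
move=> hg; have [gG g0 gd] := hg; have [D hD] := mderive_orbit_mx hg.
exists D; split=> // w.
have h := mderive_retr (mderiveM hD (mderive_cst (su_val w : M))).
rewrite mulmx0 addr0 in h.
apply: is_derive_uniq (gd w) _; apply: (is_derive_eqfun _ h) => s.
by rewrite to_orbit_retr.
Qed.

Lemma tangent_coad p v : Gr r p -> tangent (Gr r) x p v ->
  exists X : su R n, v = coad X (x p).
Proof.
move=> pG [g hg]; have [gG g0 gd] := hg.
have [D [hD vE]] := velocity_mx hg.
have DQ : D *m Q p + Q p *m D = eta *: D.
  have h1 := mderiveM hD hD; rewrite g0 in h1.
  apply: mderive_uniq h1 (mderive_ext _ (mderiveZ eta hD)) => s.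
  by rewrite orbit_mx_sq.
have DN : D^t* = - D.
  have h1 := mderive_trmxC hD.
  have h2 := mderiveZ (-1) hD; rewrite scaleN1r in h2.
  apply: mderive_uniq h1 (mderive_ext _ h2) => s.
  by rewrite scaleN1r orbit_mx_trmxC.
have XS : (eta^-1 ^+ 2 *: lbr D (Q p) : cmx R n) \in in_su (n := n).
  apply/in_suP; split; last by rewrite mxtraceZ mxtrace_lbr mulr0.
  have -> : (eta^-1 ^+ 2 *: lbr D (Q p))^t* = eta^-1 ^+ 2 *: (lbr D (Q p))^t*.
    apply/matrixP => i j; rewrite !mxE rmorphM rmorphXn; congr (_ * _).
    by rewrite fmorphV -/(Num.conj eta) conj_eta invrN sqrrN.
  rewrite trmxC_lbr DN orbit_mx_trmxC // -scalerN; congr (_ *: _).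
  by rewrite /lbr !mulNmx !mulmxN !opprK opprB.
exists (Su XS); apply/funext => w; rewrite coadE // vE /=.
rewrite /retr tr_lbr_cycle; congr (complex.Re (\tr (_ *m _))).
have -> : lbr (eta^-1 ^+ 2 *: lbr D (Q p)) (Q p) = eta^-1 ^+ 2 *: lbr (lbr D (Q p)) (Q p).
  by rewrite /lbr -scalemxAl -scalemxAr scalerBr.
rewrite (lbr_lbr_idem eta0 (orbit_mx_sq pG) DQ) scalerA -exprMn mulVf //.
by rewrite expr1n scale1r.
Qed.

Local Notation Z p a := (twist_vec (tr_form (lbr (Q p) (su_val a)))).
Local Notation std := (@std_twist R n).

Lemma coad_tr_form (X : su R n) p w : Gr r p ->
  coad X (x p) w = tr_form (lbr (Q p) (su_val w)) X.
Proof. by move=> pG; rewrite coadE // /tr_form /retr tr_lbr. Qed.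

Lemma orbit_lieC p (X Y : su R n) : Gr r p -> x p (lie X Y) = - x p (lie Y X).
Proof.
by move=> pG; rewrite !to_orbit_retr // !lbr_su lbrC mulmxN retrN.
Qed.

Lemma omega_KK_coad p (X Y : su R n) : Gr r p ->
  omega_KK xi0 p (coad X (x p)) (coad Y (x p)) = x p (lie X Y).
Proof.
move=> pG; rewrite /omega_KK; case: xgetP => [c _ [X' [Y' [eX eY ->]]]|no].
  have eY' : x p (lie X' Y) = x p (lie X' Y') := congr1 (fun f => f X') eY.
  have eX' : x p (lie Y X) = x p (lie Y X') := congr1 (fun f => f Y) eX.
  have e1 := orbit_lieC X' Y pG; have e2 := orbit_lieC X Y pG.
  by rewrite eY' eX' in e1 e2; rewrite e1 e2.
by case: (no (x p (lie X Y))); exists X, Y.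
Qed.

Lemma bivector_of_omega_KK p a : Gr r p ->
  bivector_of_form (Gr r) x (omega_KK xi0) p a = coad a (x p).
Proof.
move=> pG; rewrite /bivector_of_form; case: xgetP => [v _ [tv hv]|no].
  have [X eX] := tangent_coad pG tv; subst v; apply/funext => Y.
  have e : x p (lie X Y) = x p (lie a Y).
    exact: etrans (esym (omega_KK_coad X Y pG)) (hv _ (coad_tangent Y pG)).
  have e1 := orbit_lieC Y X pG; have e2 := orbit_lieC Y a pG.
  by rewrite e in e1; exact: etrans e1 (esym e2).
case: (no (coad a (x p))); split; first exact: coad_tangent.
by move=> u /(tangent_coad pG) [Y ->]; exact: omega_KK_coad.
Qed.

Lemma fund_twist_std lam p a b : Gr r p ->
  fund_twist x (scale_twist lam std) p a b =
  lam * std (tr_form (lbr (Q p) (su_val a))) (tr_form (lbr (Q p) (su_val b))).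
Proof.
move=> pG; rewrite /fund_twist /scale_twist; congr (_ * std _ _).
  by apply/funext => X; rewrite fund_coad // coad_tr_form.
by apply/funext => X; rewrite fund_coad // coad_tr_form.
Qed.

Definition deformed lam p a b : R :=
  bivector_of_form (Gr r) x (omega_KK xi0) p a b
  - fund_twist x (scale_twist lam std) p a b.

Lemma sharp_deformed lam p a : Gr r p ->
  sharp (deformed lam) p a = coad (a - lam *: Z p a) (x p).
Proof.
move=> pG; apply/funext => b; rewrite /sharp /deformed bivector_of_omega_KK //.
by rewrite fund_twist_std // std_twistE !coad_tr_form // tr_formD tr_formN (tr_formZ _ lam).
Qed.

Lemma deformed_differential lam p v a b : Gr r p -> tangent (Gr r) x p v ->
  differential (Gr r) x (fun q => deformed lam q a b) p v =
  v (lie b a) - lam * (v (lie b (Z p a)) - v (lie a (Z p b))).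
Proof.
move=> pG tv; apply: curve_differential => // g hg; have [gG g0 gd] := hg.
have [D [hD vE]] := velocity_mx hg.
have hl (w : su R n) : mderive (fun s => lbr (Q (g s)) (su_val w)) (lbr D (su_val w)).
  have h := mderiveB (mderiveM hD (mderive_cst (su_val w : M)))
    (mderiveM (mderive_cst (su_val w : M)) hD).
  by rewrite !mulmx0 mul0mx addr0 add0r in h.
have h := is_deriveB (gd (lie b a))
  (is_deriveZ lam (mderive_std_twist (hl a) (hl b))).
rewrite !g0 in h.
have e (w w' : su R n) : v (lie w w') = retr (lbr D (su_val w) *m (su_val w' : M)).
  by rewrite vE lbr_su /retr tr_lbr.
have h' := is_derive_eq h (congr2 (fun y z => v (lie b a) - lam * (y - z))
  (esym (e b (Z p a))) (esym (e a (Z p b)))).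
apply: (is_derive_eqfun _ h') => s.
by rewrite /deformed /= bivector_of_omega_KK // fund_twist_std.
Qed.

Lemma lbr_orbit_trmxC p (a : su R n) : Gr r p ->
  (lbr (Q p) (su_val a))^t* = - lbr (Q p) (su_val a).
Proof.
move=> pG; rewrite trmxC_lbr su_trmxC orbit_mx_trmxC //.
by rewrite /lbr !mulNmx !mulmxN !opprK opprB.
Qed.

Lemma orbit_twist_cycle p (a b c : su R n) : Gr r p ->
  retr (lbr (Q p) (su_val a) *m lbr (su_val (Z p b)) (su_val (Z p c)))
  + retr (lbr (Q p) (su_val b) *m lbr (su_val (Z p c)) (su_val (Z p a)))
  + retr (lbr (Q p) (su_val c) *m lbr (su_val (Z p a)) (su_val (Z p b))) = 0.
Proof.
move=> pG; have hat w : lbr (Q p) (su_val w) - (lbr (Q p) (su_val w))^t* =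
    lbr (Q p) (su_val w) + lbr (Q p) (su_val w) by rewrite lbr_orbit_trmxC // opprK.
apply: etrans (twist_vec_cycle (hat a) (hat b) (hat c)) _.
have QQ := orbit_mx_sq pG; have reg : GRing.lreg eta by apply/lregP.
have tz (A B D : su R n) : \tr (lbr (Q p) (su_val A) *m lbr (Q p) (su_val B)
  *m lbr (Q p) (su_val D)) = 0 := tr_comm_idem_triple _ _ _ reg QQ.
have h := congr1 (@complex.Re R) (tr_double_lbr (tz c a b) (tz c b a)).
by apply: etrans (mulr0 _); congr (_ * _); exact: h.
Qed.

Definition triple_form (L u v w : M) : R := retr (L *m lbr (lbr u v) w).

Lemma retr_lbr_lbr L w u v : retr (lbr L w *m lbr u v) = - triple_form L u v w.
Proof.
have -> : retr (lbr L w *m lbr u v) = retr (L *m lbr w (lbr u v)).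
  exact: (congr1 (@complex.Re R) (tr_lbr L w (lbr u v))).
by rewrite (lbrC w) mulmxN retrN.
Qed.

Lemma triple_formC L u v w : triple_form L u v w = - triple_form L v u w.
Proof. by rewrite /triple_form [lbr u v]lbrC lbrNl mulmxN retrN. Qed.

Lemma triple_form_jacobi L u v w :
  triple_form L u v w + triple_form L v w u + triple_form L w u v = 0.
Proof.
rewrite /triple_form -2!retrD -2!mulmxDr.
by rewrite (lbr_jacobi_cycle u v w) mulmx0 /retr mxtrace0.
Qed.

Lemma coad_lie lam p (u v c : su R n) : Gr r p ->
  coad (c - lam *: Z p c) (x p) (lie u v) =
  triple_form (Q p) (su_val u) (su_val v) (su_val c)
  - lam * triple_form (Q p) (su_val u) (su_val v) (su_val (Z p c)).
Proof.
move=> pG; rewrite coad_tr_form // tr_formD tr_formN (tr_formZ _ lam).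
by rewrite /tr_form /triple_form /retr !tr_lbr.
Qed.

Lemma schouten_term_deformed lam p (a b c : su R n) : Gr r p ->
  schouten_term (Gr r) x (deformed lam) (deformed lam) p a b c =
  2 * (triple_form (Q p) (su_val b) (su_val a) (su_val c)
    - lam * triple_form (Q p) (su_val b) (su_val a) (su_val (Z p c))
    - lam * (triple_form (Q p) (su_val b) (su_val (Z p a)) (su_val c)
      - lam * triple_form (Q p) (su_val b) (su_val (Z p a)) (su_val (Z p c))
      - (triple_form (Q p) (su_val a) (su_val (Z p b)) (su_val c)
        - lam * triple_form (Q p) (su_val a) (su_val (Z p b)) (su_val (Z p c))))).
Proof.
move=> pG; have tg := coad_tangent (c - lam *: Z p c) pG.
have double (y z : R) : y = z -> y + y = 2 * z by move=> ->; ring.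
apply: double; rewrite sharp_deformed //.
apply: etrans (deformed_differential lam a b pG tg) _.
have e u v := coad_lie lam u v c pG.
exact: (congr2 (fun s t : R => s - lam * t) (e b a)
  (congr2 (fun s t : R => s - t) (e b (Z p a)) (e a (Z p b)))).
Qed.

(* The terms of order 0 and 1 in lam vanish by the Jacobi identity, which also
   turns the terms of order 2 into the last hypothesis. *)
Lemma jacobi_deformation (T : Type) (g : T -> T -> T -> R) (lam : R) (a b c x y z : T) :
  (forall u v w, g u v w = - g v u w) ->
  (forall u v w, g u v w + g v w u + g w u v = 0) ->
  g y z a + g z x b + g x y c = 0 ->
  2 * (g b a c - lam * g b a z
    - lam * (g b x c - lam * g b x z - (g a y c - lam * g a y z)))
  + 2 * (g c b a - lam * g c b x
    - lam * (g c y a - lam * g c y x - (g b z a - lam * g b z x)))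
  + 2 * (g a c b - lam * g a c y
    - lam * (g a z b - lam * g a z y - (g c x b - lam * g c x y))) = 0.
Proof.
move=> anti jac h.
have e0 : g b a c = - g c b a - g a c b by have := jac b a c; lra.
have rel u v w : g u v w = g u w v - g v w u.
  by have := jac u v w; have := anti w u v; lra.
rewrite e0 (rel b a z) (rel c b x) (rel a c y) (rel b z x) (rel c x y) (rel a y z).
have -> : g y z a = - g z x b - g x y c by move: h; lra.
ring.
Qed.

Lemma schouten_deformed lam p (a b c : su R n) : Gr r p ->
  schouten (Gr r) x (deformed lam) (deformed lam) p a b c = 0.
Proof.
move=> pG; apply: etrans (congr2 +%R (congr2 +%R (schouten_term_deformed lam a b c pG)
  (schouten_term_deformed lam b c a pG)) (schouten_term_deformed lam c a b pG)) _.
apply: jacobi_deformation; [exact: triple_formC | exact: triple_form_jacobi |].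
have e := retr_lbr_lbr (Q p).
have := orbit_twist_cycle a b c pG.
have sum3 (s t u s' t' u' : R) : s = - s' -> t = - t' -> u = - u' ->
  s + t + u = 0 -> s' + t' + u' = 0 by move=> -> -> ->; lra.
exact: sum3 (e _ _ _) (e _ _ _) (e _ _ _).
Qed.

Lemma deformed_smooth lam a b : smooth (Gr r) x (fun p => deformed lam p a b).
Proof.
pose T : finType := option ('I_n * 'I_n * bool * bool).
pose w (t : T) : su R n := match t with
  | None => lie b a
  | Some (i, j, s, e) => lie (if s then a else b) (if e then Xsu R i j else Ysu R i j)
  end.
pose y_ (y : 'rV[R]_#|T|) (t : T) : R := y ord0 (enum_rank t).
pose F (y : 'rV[R]_#|T|) : R := y_ y None + - (lam * (4 * n%:R)^-1) *
  \sum_(i < n) \sum_(j < n | (i < j)%N)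
    (y_ y (Some (i, j, true, true)) * y_ y (Some (i, j, false, false))
     + -1 * (y_ y (Some (i, j, true, false)) * y_ y (Some (i, j, false, true)))).
exists #|T|, (fun i => w (enum_val i)), F; split.
  have hc c k : Ck k (fun _ : 'rV[R]_#|T| => c) := Ck_cst _ c k.
  have hy t k : Ck k (y_^~ t) := Ck_coord _ _ k.
  move=> k; apply: CkD => //; apply: CkM => // {}k.
  apply: Ck_sum => i; apply: Ck_sum => j; apply: CkD; first exact: CkM.
  by apply: CkM => //; apply: CkM.
move=> p pG; rewrite /deformed bivector_of_omega_KK //.
have yE t : y_ (\row_i x p (w (enum_val i))) t = x p (w t).
  by rewrite /y_ mxE enum_rankK.
rewrite /F yE mulNr; congr (_ - _).
rewrite /fund_twist /scale_twist /std_twist mulrA; congr (_ * _).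
apply: eq_bigr => i _; apply: eq_bigr => j _; rewrite /wedge !fund_coad // !yE.
by rewrite mulN1r.
Qed.

Lemma deformedC lam p a b : Gr r p -> deformed lam p a b = - deformed lam p b a.
Proof.
move=> pG; rewrite /deformed !bivector_of_omega_KK // !fund_twist_std //.
have e1 : coad a (x p) b = - coad b (x p) a := orbit_lieC b a pG.
have gen (s t : R) : - s - lam * - t = - (s - lam * t) by ring.
exact: etrans (congr2 (fun s t : R => s - lam * t) e1 (std_twistC _ _)) (gen _ _).
Qed.

Lemma deformed_poisson lam : poisson (Gr r) x (deformed lam).
Proof.
split; last by move=> p pG a b c; apply: schouten_deformed.
split; [exact: deformed_smooth | by move=> p pG a b; apply: deformedC |].
by move=> p pG a; rewrite sharp_deformed //; apply: coad_tangent.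
Qed.

Lemma lbr_orbit_in_su p (a : su R n) : Gr r p ->
  (lbr (Q p) (su_val a) : cmx R n) \in in_su (n := n).
Proof. by move=> pG; apply/in_suP; rewrite lbr_orbit_trmxC // mxtrace_lbr. Qed.

Lemma lbr_orbit_eq0 p (a : su R n) : Gr r p ->
  (forall w : su R n, tr_form (lbr (Q p) (su_val a)) w = 0) -> lbr (Q p) (su_val a) = 0.
Proof.
move=> pG h; have e : Su (lbr_orbit_in_su a pG) = 0.
  by apply: su_ext => // w; rewrite mul0mx /retr mxtrace0; exact: h.
exact: (congr1 (@su_val R n) e).
Qed.

Lemma conormalE p (a : su R n) : Gr r p ->
  conormal (Gr r) x p a <-> lbr (Q p) (su_val a) = 0.
Proof.
move=> pG; split=> [h|h v].
  apply: lbr_orbit_eq0 => // w; rewrite -coad_tr_form //.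
  by apply: h; apply: coad_tangent.
by move=> /(tangent_coad pG) [X ->]; rewrite coad_tr_form // h /tr_form mul0mx /retr mxtrace0.
Qed.

Lemma coad_eq0 p (b : su R n) : Gr r p ->
  coad b (x p) = (fun=> 0) <-> lbr (Q p) (su_val b) = 0.
Proof.
move=> pG; have e w : coad b (x p) w = - tr_form (lbr (Q p) (su_val b)) w.
  by rewrite -coad_tr_form //; exact: orbit_lieC.
split=> [h|h].
  apply: lbr_orbit_eq0 => // w; apply/eqP; rewrite -oppr_eq0 -e; apply/eqP.
  exact: (congr1 (fun f => f w) h).
by apply/funext => w; rewrite e h /tr_form mul0mx /retr mxtrace0 oppr0.
Qed.

Lemma twist_vec_orbit p a : Gr r p ->
  su_val (Z p a) = (0 +i* - kap R n) *: tri_lbr (Q p) (su_val a).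
Proof. by move=> pG; rewrite twist_vecE (lbr_orbit_trmxC a pG) opprK. Qed.

Lemma orbit_mx_bound : exists2 k : R, 0 <= k &
  forall p, Gr r p -> 4 * entry_norm (Q p) <= k%:C.
Proof.
pose K : C := 4 * (n%:R * n%:R * entry_norm (eta *: pid_mx r : M) * (n%:R * n%:R)).
have K0 : 0 <= K by rewrite !mulr_ge0 // entry_norm_ge0.
have /complex_realP[k kE] : K \is Num.real by apply: ger0_real.
exists k; first by move: K0; rewrite kE lecR.
move=> p pG; rewrite -kE /K /Q unlock; apply: ler_wpM2l => //.
have [gU _] := Gr_xget pG; have [hU _] := SUV (Gr_xget pG).
apply: le_trans (entry_normM _ _) _; apply: ler_pM; rewrite ?entry_norm_ge0 //.
  apply: le_trans (entry_normM _ _) _; apply: ler_pM; rewrite ?entry_norm_ge0 //.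
  exact: (entry_norm_unitary gU).
exact: (entry_norm_unitary hU).
Qed.

Lemma entry_norm_twist (L A B : M) (k : R) : 4 * entry_norm L <= k%:C ->
  entry_norm B <= 2 * entry_norm A ->
  2 * entry_norm L * entry_norm B <= k%:C * entry_norm A.
Proof.
move=> hk hB; apply: (@le_trans _ _ (4 * entry_norm L * entry_norm A)).
  rewrite (_ : 4 * _ * _ = 2 * entry_norm L * (2 * entry_norm A)); last by ring.
  by apply: ler_wpM2l => //; apply: mulr_ge0 => //; apply: entry_norm_ge0.
by apply: ler_wpM2r => //; apply: entry_norm_ge0.
Qed.

Lemma entry_norm_double (A : M) : entry_norm (A + A) <= 2 * entry_norm A.
Proof. by rewrite mulr2n mulrDl mul1r; exact: entry_normD. Qed.

Lemma tri_lbr_fixpoint0 (L A : M) (k : R) (z : C) : 4 * entry_norm L <= k%:C ->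
  `|z| * k%:C < 1 -> A = z *: tri_lbr L A -> A = 0.
Proof.
move=> hk hz eA; apply: contraction_fixpoint0 _ eA hz.
apply: le_trans (entry_norm_tri_sgn _) _.
apply: le_trans (entry_norm_double _) _.
apply: le_trans (ler_wpM2l _ (entry_norm_lbr _ _)) _ => //.
have -> : 2 * (2 * entry_norm L * entry_norm A) = 4 * entry_norm L * entry_norm A.
  by ring.
by apply: ler_wpM2r => //; apply: entry_norm_ge0.
Qed.

Lemma lbr_tri_lbr_fixpoint0 (L A : M) (k : R) (z : C) : 4 * entry_norm L <= k%:C ->
  `|z| * k%:C < 1 -> lbr L A = z *: lbr L (tri_lbr L A) -> lbr L A = 0.
Proof.
move=> hk hz eA; apply: contraction_fixpoint0 _ eA hz.
apply: le_trans (entry_norm_lbr _ _) _; apply: entry_norm_twist => //.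
exact: le_trans (entry_norm_tri_sgn _) (entry_norm_double _).
Qed.

Lemma tri_lbr_trmxC p (A : M) : Gr r p ->
  (tri_lbr (Q p) A)^t* = - tri_lbr (Q p) (A^t*).
Proof.
move=> pG; have e : (lbr (Q p) A)^t* = lbr (Q p) (A^t*).
  by rewrite trmxC_lbr (orbit_mx_trmxC pG) lbrC lbrNl opprK.
rewrite /tri_lbr -e; move: (lbr (Q p) A) => H.
apply/matrixP => i j; rewrite !mxE (ord_sgnC _ i j) /ord_sgn.
by rewrite rmorphM rmorphB rmorphD !rmorph_nat /=; ring.
Qed.

Lemma trmxC_subZ (A B : M) z : (A - z *: B)^t* = A^t* - Num.conj z *: B^t*.
Proof. by apply/matrixP => i j; rewrite !mxE rmorphB rmorphM. Qed.

(* The equation is solved over all complex matrices, where the operator is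
   C-linear and injective; by uniqueness the solution is antihermitian. *)
Lemma deformed_solve p lam (k : R) (X : su R n) : Gr r p ->
  4 * entry_norm (Q p) <= k%:C -> `|lam%:C * (0 +i* - kap R n) : C| * k%:C < 1 ->
  exists a : su R n, a - lam *: Z p a = X.
Proof.
set z : C := lam%:C * _ => pG hk hlam.
have cz : Num.conj z = - z.
  by apply: cplx_ext; rewrite /z ?(ReC, ImC, ReM, ImM, ReN, ImN) /=; ring.
pose f : {linear M -> M} := tri_lbr_resolvent z (Q p).
have fE A : f A = A - z *: tri_lbr (Q p) A by [].
have f0 A : f A = 0 -> A = 0.
  by rewrite fE => /eqP; rewrite subr_eq0 => /eqP; apply: tri_lbr_fixpoint0 hk hlam.
have [A fA] := injective_linear_solve (su_val X : M) f0.
have fT : (f A)^t* = f (A^t*).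
  by rewrite !fE trmxC_subZ cz (tri_lbr_trmxC A pG) scalerN scaleNr opprK.
have AS : (A : cmx R n) \in in_su (n := n).
  apply/in_suP; split.
    apply/eqP; rewrite -addr_eq0; apply/eqP/f0.
    have fD B D : f (B + D) = f B + f D by exact: raddfD.
    by rewrite fD -fT fA su_trmxC addNr.
  have := su_tr X; rewrite -fA fE raddfB /= mxtraceZ.
  by rewrite mxtrace_tri_sgn mulr0 subr0.
exists (Su AS); apply: val_inj; apply: etrans (su_valBZ lam (Su AS) _) _.
by rewrite (twist_vec_orbit (Su AS) pG) scalerA; exact: fA.
Qed.

Lemma deformed_nondegenerate lam (k : R) :
  (forall p, Gr r p -> 4 * entry_norm (Q p) <= k%:C) ->
  `|lam%:C * (0 +i* - kap R n) : C| * k%:C < 1 ->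
  Defs.nondegenerate (Gr r) x (deformed lam).
Proof.
move=> hk hlam p pG; have hkp := hk p pG; split=> [a|v tv]; last first.
  have [X ->] := tangent_coad pG tv; have [a ea] := deformed_solve X pG hkp hlam.
  exists a.
  exact: (etrans (sharp_deformed lam a pG) (congr1 (fun b => coad b (x p)) ea)).
rewrite (sharp_deformed lam a pG).
have lbrE : lbr (Q p) (su_val (a - lam *: Z p a)) = lbr (Q p) (su_val a)
    - (lam%:C * (0 +i* - kap R n)) *: lbr (Q p) (tri_lbr (Q p) (su_val a)).
  by rewrite su_valBZ (twist_vec_orbit a pG) scalerA lbr_subZ.
split=> [/(coad_eq0 _ pG)|/(conormalE _ pG) h].
  rewrite lbrE => /eqP; rewrite subr_eq0 => /eqP h.
  by apply/(conormalE _ pG); apply: lbr_tri_lbr_fixpoint0 hkp hlam h.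
apply/(coad_eq0 _ pG); rewrite lbrE /tri_lbr h.
by rewrite addr0 linear0 /lbr mulmx0 mul0mx subr0 scaler0 subr0.
Qed.

End Orbit.

Theorem theorem4p2 (R : realType) (n r : nat) (hr1 : (1 <= r)%N)
    (hr2 : (r <= n - 1)%N) (xi0 : {linear su R n -> R^o})
    (hxi0 : stabilizer_is r xi0) :
  rmatrix (@std_twist R n) /\
  exists lam0 : R, 0 < lam0 /\
    forall lam : R, `|lam| <= lam0 ->
      deformed_by (@Gr R n r) (to_orbit xi0) (omega_KK xi0)
        (scale_twist lam (@std_twist R n)).
Proof.
split; first exact: rmatrix_std_twist.
have rn : (r < n)%N by lia.
have n0 : (0 < n)%N by lia.
have [eta [eta0 ceta xi0E]] := stabilizer_form hr1 rn hxi0.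
have [k k0 hk] := @orbit_mx_bound R n r eta.
have kap0 : 0 <= kap R n by rewrite invr_ge0 mulr_ge0.
exists (kap R n * k + 1)^-1; split; first by rewrite invr_gt0 ltr_wpDl ?mulr_ge0.
move=> lam hlam; split.
  exact: (deformed_poisson n0 (ltnW rn) hxi0 eta0 ceta xi0E lam).
apply: (deformed_nondegenerate n0 (ltnW rn) hxi0 eta0 ceta xi0E hk).
move: hk hlam; set K := kap R n * k + 1 => hk hlam.
have K0 : 0 < K by rewrite ltr_wpDl ?mulr_ge0.
have -> : `|lam%:C * (0 +i* - kap R n) : R[i]| = (`|lam| * kap R n)%:C.
  have -> : lam%:C * (0 +i* - kap R n) = (lam * kap R n)%:C * - 'i%C :> R[i].
    by apply: cplx_ext => /=; ring.
  rewrite normrM normrN normc_def /= expr0n /= addr0 sqrtr_sqr normrM.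
  by rewrite (ger0_norm kap0) normc_def /= expr0n /= add0r expr1n sqrtr1 mulr1.
rewrite -rmorphM /= -[1]/(1%:C) ltcR.
apply: (@le_lt_trans _ _ (K^-1 * (kap R n * k))).
  by rewrite -mulrA; apply: ler_wpM2r => //; rewrite mulr_ge0.
by rewrite mulrC ltr_pdivrMr // mul1r ltrDl.
Qed.
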